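(* Let $\Omega\subset\mathbb{R}^3$ be a simply connected domain, let $u:\Omega\to\mathbb{C}$, and let $\mathbf{h}=\operatorname{grad}\xi$ (with $\xi:\Omega\to\mathbb{C}$ a scalar function) be a particular solution in $\Omega$ of the quaternionic Riccati equation $$D\mathbf{q}+\mathbf{q}^2=-u,$$ where the unknown $\mathbf{q}$ is a purely vectorial biquaternion valued function. Then the general solution of this equation has the form $\mathbf{q}=\mathbf{h}+\mathbf{g}$, where $\mathbf{g}=\dfrac{D\Psi}{\Psi}$ and $\Psi$ is obtained from the equation $$\operatorname{grad}\Psi=e^{-\xi}\mathbf{F},$$ where $\mathbf{F}$ is the general purely vectorial solution of $(D+M^{\mathbf{h}})\mathbf{F}=0$. That is: for every purely vectorial solution $\mathbf{F}$ of $(D+M^{\mathbf{h}})\mathbf{F}=0$ in $\Omega$ there is a scalar function $\Psi:\Omega\to\mathbb{C}$ with $\operatorname{grad}\Psi=e^{-\xi}\mathbf{F}$; and a purely vectorial function $\mathbf{q}$ on $\Omega$ is a solution of $D\mathbf{q}+\mathbf{q}^2=-u$ if and only if $\mathbf{q}=\mathbf{h}+\frac{D\Psi}{\Psi}$ for some nonvanishing scalar function $\Psi:\Omega\to\mathbb{C}$ such that $\operatorname{grad}\Psi=e^{-\xi}\mathbf{F}$ for some purely vectorial solution $\mathbf{F}$ of $(D+M^{\mathbf{h}})\mathbf{F}=0$ in $\Omega$.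
   Context: $\mathbb{H}(\mathbb{C})$ is the algebra of complex quaternions (biquaternions) $q=q_0+q_1\mathbf{i}+q_2\mathbf{j}+q_3\mathbf{k}$, $q_k\in\mathbb{C}$, where $\mathbf{i},\mathbf{j},\mathbf{k}$ are the standard quaternionic units, commuting with the complex scalars. $q$ is purely vectorial if $q_0=0$; purely vectorial biquaternions $\mathbf{q}=q_1\mathbf{i}+q_2\mathbf{j}+q_3\mathbf{k}$ are identified with vectors of $\mathbb{C}^3$, and $\mathbf{q}^2=-\langle\mathbf{q},\mathbf{q}\rangle$ with $\langle\mathbf{p},\mathbf{q}\rangle=\sum_k p_kq_k$ (bilinear). $M^{p}$ is right multiplication: $M^pq=q\cdot p$. For a differentiable biquaternion valued function $q$ of $\mathbf{x}=(x_1,x_2,x_3)$, $Dq=\mathbf{i}\,\partial_{x_1}q+\mathbf{j}\,\partial_{x_2}q+\mathbf{k}\,\partial_{x_3}q$. For a scalar function $\Psi$, $D\Psi=\operatorname{grad}\Psi=\mathbf{i}\,\partial_{x_1}\Psi+\mathbf{j}\,\partial_{x_2}\Psi+\mathbf{k}\,\partial_{x_3}\Psi$. Solutions are classical: vector fields $\mathbf{q},\mathbf{h},\mathbf{F}$ are continuously differentiable and scalar functions $\xi,\Psi$ are twice continuously differentiable. *)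

(* Defs.v *)
From HB Require Import structures.
From mathcomp Require Import all_boot all_order all_algebra.
From mathcomp Require Import complex ring.
From mathcomp Require Import all_classical all_reals all_analysis.
Import Order.TTheory GRing.Theory Num.Theory.
Import numFieldNormedType.Exports.

Set Implicit Arguments.
Unset Strict Implicit.
Unset Printing Implicit Defensive.

Local Open Scope classical_set_scope.
Local Open Scope ring_scope.
Local Open Scope complex_scope.

(* Hamilton quaternions with coefficients in K; the biquaternions H(C) are
   [quat R[i]], whose imaginary units commute with the complex scalars. *)
Record quat (K : Type) := Quat { q0 : K; q1 : K; q2 : K; q3 : K }.

Definition quat_tuple (K : Type) (q : quat K) : K * K * K * K :=
  (q0 q, q1 q, q2 q, q3 q).
Definition tuple_quat (K : Type) (t : K * K * K * K) : quat K :=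
  Quat t.1.1.1 t.1.1.2 t.1.2 t.2.
Lemma quat_tupleK (K : Type) : cancel (@quat_tuple K) (@tuple_quat K).
Proof. by case. Qed.

HB.instance Definition _ (K : eqType) :=
  Equality.copy (quat K) (can_type (@quat_tupleK K)).
HB.instance Definition _ (K : choiceType) :=
  Choice.copy (quat K) (can_type (@quat_tupleK K)).

Section QuatAlgebra.
Variable K : comNzRingType.
Implicit Types (p q r : quat K) (c : K).

Definition quat_zero : quat K := Quat 0 0 0 0.
Definition quat_one : quat K := Quat 1 0 0 0.
Definition quat_opp q := Quat (- q0 q) (- q1 q) (- q2 q) (- q3 q).
Definition quat_add p q :=
  Quat (q0 p + q0 q) (q1 p + q1 q) (q2 p + q2 q) (q3 p + q3 q).
Definition quat_mul p q := Quat
  (q0 p * q0 q - q1 p * q1 q - q2 p * q2 q - q3 p * q3 q)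
  (q0 p * q1 q + q1 p * q0 q + q2 p * q3 q - q3 p * q2 q)
  (q0 p * q2 q - q1 p * q3 q + q2 p * q0 q + q3 p * q1 q)
  (q0 p * q3 q + q1 p * q2 q - q2 p * q1 q + q3 p * q0 q).
Definition quat_scale c q := Quat (c * q0 q) (c * q1 q) (c * q2 q) (c * q3 q).

Lemma quat_addA : associative quat_add.
Proof. by move=> p q r; congr Quat => /=; ring. Qed.
Lemma quat_addC : commutative quat_add.
Proof. by move=> p q; congr Quat => /=; ring. Qed.
Lemma quat_add0 : left_id quat_zero quat_add.
Proof. by case=> a b c d; congr Quat => /=; ring. Qed.
Lemma quat_addN : left_inverse quat_zero quat_opp quat_add.
Proof. by move=> p; congr Quat => /=; ring. Qed.

HB.instance Definition _ :=
  GRing.isZmodule.Build (quat K) quat_addA quat_addC quat_add0 quat_addN.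

Lemma quat_mulA : associative quat_mul.
Proof. by move=> p q r; congr Quat => /=; ring. Qed.
Lemma quat_mul1l : left_id quat_one quat_mul.
Proof. by case=> a b c d; congr Quat => /=; ring. Qed.
Lemma quat_mul1r : right_id quat_one quat_mul.
Proof. by case=> a b c d; congr Quat => /=; ring. Qed.
Lemma quat_mulDl : left_distributive quat_mul +%R.
Proof. by move=> p q r; congr Quat => /=; ring. Qed.
Lemma quat_mulDr : right_distributive quat_mul +%R.
Proof. by move=> p q r; congr Quat => /=; ring. Qed.
Lemma quat_one_neq0 : quat_one != 0.
Proof. by apply/eqP => -[/eqP]; rewrite oner_eq0. Qed.

HB.instance Definition _ := GRing.Zmodule_isNzRing.Build (quat K)
  quat_mulA quat_mul1l quat_mul1r quat_mulDl quat_mulDr quat_one_neq0.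

Lemma quat_scaleA a b q :
  quat_scale a (quat_scale b q) = quat_scale (a * b) q.
Proof. by congr Quat => /=; ring. Qed.
Lemma quat_scale1 : left_id 1 quat_scale.
Proof. by case=> a b c d; congr Quat => /=; ring. Qed.
Lemma quat_scaleDr : right_distributive quat_scale +%R.
Proof. by move=> c p q; congr Quat => /=; ring. Qed.
Lemma quat_scaleDl q : {morph quat_scale^~ q : a b / a + b}.
Proof. by move=> a b; congr Quat => /=; ring. Qed.

HB.instance Definition _ := GRing.Zmodule_isLmodule.Build K (quat K)
  quat_scaleA quat_scale1 quat_scaleDr quat_scaleDl.

Lemma quat_scaleAl c p q : c *: (p * q) = (c *: p) * q.
Proof. by congr Quat => /=; ring. Qed.
HB.instance Definition _ :=
  GRing.Lmodule_isLalgebra.Build K (quat K) quat_scaleAl.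

Lemma quat_scaleAr c p q : c *: (p * q) = p * (c *: q).
Proof. by congr Quat => /=; ring. Qed.
HB.instance Definition _ :=
  GRing.Lalgebra_isAlgebra.Build K (quat K) quat_scaleAr.

Definition qi : quat K := Quat 0 1 0 0.
Definition qj : quat K := Quat 0 0 1 0.
Definition qk : quat K := Quat 0 0 0 1.

Lemma quat_hamilton :
  [/\ qi ^+ 2 = -1, qj ^+ 2 = -1, qk ^+ 2 = -1 & qi * qj * qk = -1].
Proof. by split; congr Quat => /=; ring. Qed.

Lemma quat_decomp q :
  q = (q0 q)%:A + q1 q *: qi + q2 q *: qj + q3 q *: qk.
Proof. by case: q => a b c d; congr Quat => /=; ring. Qed.

Definition rmulq p q : quat K := q * p.

End QuatAlgebra.

Arguments qi {K}.
Arguments qj {K}.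
Arguments qk {K}.

Section Analysis.
Variable R : realType.

Definition cexp (z : R[i]) : R[i] :=
  (expR (complex.Re z))%:C *
  (cos (complex.Im z) +i* sin (complex.Im z)).

Local Notation E3 := 'rV[R]_3.
Implicit Types (O : set E3).

(* Functions on a subset [O] of R^3 are total functions on R^3 of which only
   the values on [O] matter; [O] is always open below, so that derivatives at
   points of [O] depend only on these values. *)

Definition basis_vec (k : 'I_3) : E3 := delta_mx 0 k.

Definition realC1 O (f : E3 -> R) : Prop :=
  forall x, O x -> differentiable f x /\
    forall k, {for x, continuous ('D_(basis_vec k) f)}.

(* Derivatives of complex-valued functions of real variables are taken
   separately on the real and imaginary parts. *)
Definition partial (k : 'I_3) (f : E3 -> R[i]) (x : E3) : R[i] :=
  'D_(basis_vec k) (fun y => complex.Re (f y)) x +i*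
  'D_(basis_vec k) (fun y => complex.Im (f y)) x.

Definition isC1 O (f : E3 -> R[i]) : Prop :=
  realC1 O (fun x => complex.Re (f x)) /\ realC1 O (fun x => complex.Im (f x)).

Definition isC2 O (f : E3 -> R[i]) : Prop :=
  isC1 O f /\ forall k, isC1 O (partial k f).

Definition qpartial (k : 'I_3) (q : E3 -> quat R[i]) (x : E3) : quat R[i] :=
  Quat (partial k (fun y => q0 (q y)) x) (partial k (fun y => q1 (q y)) x)
       (partial k (fun y => q2 (q y)) x) (partial k (fun y => q3 (q y)) x).

Definition qisC1 O (q : E3 -> quat R[i]) : Prop :=
  [/\ isC1 O (fun x => q0 (q x)), isC1 O (fun x => q1 (q x)),
      isC1 O (fun x => q2 (q x)) & isC1 O (fun x => q3 (q x))].

Definition Dop (q : E3 -> quat R[i]) (x : E3) : quat R[i] :=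
  qi * qpartial 0 q x + qj * qpartial 1 q x + qk * qpartial 2%:R q x.

Definition grad (f : E3 -> R[i]) (x : E3) : quat R[i] :=
  partial 0 f x *: qi + partial 1 f x *: qj + partial 2%:R f x *: qk.

Lemma Dop_scalar (f : E3 -> R[i]) : Dop (fun x => (f x)%:A) = grad f.
Proof.
apply/funext => x.
have p0 k : partial k (fun=> 0) x = 0.
  by rewrite /partial !derive_cst.
have pA k : qpartial k (fun x => (f x)%:A) x = (partial k f x)%:A.
  have -> : (partial k f x)%:A = Quat (partial k f x) 0 0 0 :> quat R[i].
    by congr Quat; rewrite /= ?mulr1 ?mulr0.
  by rewrite /qpartial /=; congr Quat; rewrite -?[RHS](p0 k);
    congr (partial k _ x); apply/funext => y; rewrite /= ?mulr1 ?mulr0.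
by rewrite /Dop !pA -!scalerAr !mulr1.
Qed.

Definition vectorial O (q : E3 -> quat R[i]) : Prop :=
  forall x, O x -> q0 (q x) = 0.

Definition domain O : Prop := [/\ open O, O !=set0 & connected O].

(* Every loop in [O] is homotopic in [O], with fixed base point, to a constant
   loop; path-connectedness is automatic for a [domain]. *)
Definition simply_connected O : Prop :=
  forall g : R -> E3,
    {within `[0, 1], continuous g} -> (forall t : R, t \in `[0, 1] -> O (g t)) ->
    g 0 = g 1 ->
  exists H : R * R -> E3,
    [/\ {within `[0, 1] `*` `[0, 1], continuous H},
        (forall s t : R, s \in `[0, 1] -> t \in `[0, 1] -> O (H (s, t))),
        (forall t : R, t \in `[0, 1] -> H (0, t) = g t /\ H (1, t) = g 0) &
        (forall s : R, s \in `[0, 1] -> H (s, 0) = g 0 /\ H (s, 1) = g 0)].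

Definition riccati_sol O (u : E3 -> R[i]) (q : E3 -> quat R[i]) : Prop :=
  [/\ vectorial O q, qisC1 O q &
      forall x, O x -> Dop q x + q x ^+ 2 = - (u x)%:A].

Definition linear_sol O (h F : E3 -> quat R[i]) : Prop :=
  [/\ vectorial O F, qisC1 O F &
      forall x, O x -> Dop F x + rmulq (h x) (F x) = 0].

End Analysis.

(* Main.v *)
Require Import Defs.
From HB Require Import structures.
From mathcomp Require Import all_boot all_order all_algebra.
From mathcomp Require Import complex ring lra.
From mathcomp Require Import all_classical all_reals all_analysis.
Import Order.TTheory GRing.Theory Num.Theory.
Import numFieldNormedType.Exports.
Set Implicit Arguments.
Unset Strict Implicit.
Unset Printing Implicit Defensive.
Local Open Scope classical_set_scope.
Local Open Scope ring_scope.

(** The Dirac operator sends a vector field to minus its divergence (scalar part)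
    plus its curl (vector part), and the square of a vector is the scalar
    [- <q, q>]. Hence the Riccati equation says that [q] is curl free and that
    [div q + <q, q> = u], and the linear equation for [F] says that
    [curl F = h x F] and [div F + <F, h> = 0] ([linear_equationP],
    [riccati_equationP]).

    Since [h = grad xi], the equation [curl F = h x F] means that
    [cexp (- xi) *: F] is curl free, so on a simply connected domain it is the
    gradient of some [Psi] ([linear_sol_potential]). If [q] solves the Riccati
    equation, [q - h] is curl free, hence the gradient of some [phi]; with
    [Psi = cexp phi], so that [q - h = grad Psi / Psi], the field
    [F = cexp xi *: grad Psi] solves the linear equation by the product rule and
    the difference of the two scalar Riccati equations ([riccati_sol_log]). The
    same computation read backwards gives the converse
    ([riccati_sol_of_linear]).

    The analytic core is that a closed C1 field on a simply connected domain has
    a potential ([closed_field_potential], [curl_free_gradient]). Inside a ball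
    the integrals of a closed field along the sides of a triangle add up
    ([segment_integral_triangle]), by differentiation under the integral sign. Along a
    merely continuous curve the integral is the eventual value of the sums over
    inscribed polygons. For a contractible loop these sums vanish: on a fine grid
    of the square on which the homotopy lives, every cell is sent into a ball, so
    the sum along a row of the grid does not depend on the row
    ([homotopy_chord_sum]). The integral from a base point is therefore well
    defined, and its directional derivatives are the values of the field. *)

(** * Integrals of a closed field along segments *)

Section LineIntegral.
Variable R : realType.
Local Notation E3 := 'rV[R]_3.
Local Notation mu := (@lebesgue_measure R).

Lemma derive_rowE (f : E3 -> R) (x w : E3) : differentiable f x ->
  'D_w f x = \sum_j w 0 j * 'D_(basis_vec R j) f x.
Proof.
move=> df; rewrite deriveE// {1}(row_sum_delta w) linear_sum.
by apply: eq_bigr => j _; rewrite linearZ/= deriveE.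
Qed.

Lemma is_derive_lineP (f : E3 -> R) (p w : E3) (t d : R) :
  is_derive (p + t *: w) w f d <-> is_derive t 1 (fun s : R => f (p + s *: w)) d.
Proof.
have E : (fun h : R => h^-1 *: ((fun s : R => f (p + s *: w)) (h *: 1 + t)
    - f (p + t *: w))) =
  (fun h => h^-1 *: (f (h *: w + (p + t *: w)) - f (p + t *: w))).
  apply/funext => h; congr (_ *: (f _ - _)).
  by rewrite [_%:A]mulr1 scalerDl addrCA.
by split=> -[Dv Dd]; split; move: Dv Dd; rewrite /derivable /derive /= E.
Qed.

Lemma is_derive_line (f : E3 -> R) (p w : E3) (t : R) :
  differentiable f (p + t *: w) ->
  is_derive t 1 (fun s : R => f (p + s *: w)) ('D_w f (p + t *: w)).
Proof. by move=> df; apply/is_derive_lineP/derivableP/diff_derivable. Qed.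

(** A continuous derivative is bounded on the compact rectangle, which gives the
    constant dominating function that differentiation under the integral sign
    asks for. *)
Lemma is_derive_integral01 (f df : R -> R -> R) (s d : R) : 0 < d ->
  (forall s' : R, s' \in `[s - d, s + d] ->
     {within `[0, 1], continuous (f s')}) ->
  (forall s' t : R, s' \in `[s - d, s + d] -> t \in `[0, 1] ->
     is_derive s' 1 (f^~ t) (df s' t)) ->
  {within `[s - d, s + d] `*` `[0, 1], continuous (fun z : R * R => df z.1 z.2)} ->
  is_derive s 1 (fun s' => \int[mu]_(t in `[0, 1]) f s' t)
    (\int[mu]_(t in `[0, 1]) df s t).
Proof.
move=> d0 cf isd cdf.
have cK : compact ([set` `[s - d, s + d]] `*` [set` `[(0:R), 1]]).
  by apply: compact_setX; exact: segment_compact.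
have [M [_ HM]] := compact_bounded (continuous_compact cdf cK).
pose B := `|M| + 1.
have ltMB : M < B by rewrite /B (le_lt_trans (ler_norm M))// ltrDl.
have sub x : `]s - d, s + d[%classic x -> x \in `[s - d, s + d].
  by move=> xI; exact: subset_itv_oo_cc.
have Is : `]s - d, s + d[%classic s.
  by rewrite /= in_itv/= ltrDl gtrDl oppr_lt0 d0.
have mI : measurable ([set` `[(0:R), 1]] : set (measurableTypeR R)) by [].
have int_f x : `]s - d, s + d[%classic x ->
    mu.-integrable [set` `[(0:R), 1]] (EFin \o f x).
  move=> /sub xI; apply: continuous_compact_integrable => //.
    exact: segment_compact.
  exact: cf.
have der x y : `]s - d, s + d[%classic x -> `[(0:R), 1]%classic y ->
    derivable (f ^~ y) x 1.
  by move=> /sub xI yI; have [] := isd _ _ xI yI.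
have G0 (y : R) : 0 <= B by rewrite addr_ge0.
have intG : mu.-integrable [set` `[(0:R), 1]] (EFin \o (fun _ : R => B)).
  apply: continuous_compact_integrable; first exact: segment_compact.
  by apply: continuous_subspaceT => x; exact: cvg_cst.
have ub x y : `]s - d, s + d[%classic x -> `[(0:R), 1]%classic y ->
    `|partial1of2 f x y| <= B.
  move=> /sub xI yI; rewrite partial1of2E.
  have [_ ->] := isd _ _ xI yI.
  apply: (HM _ ltMB); exists (x, y) => //=.
apply: DeriveDef.
  exact: (@derivable_under_integral R _ (measurableTypeR R) mu f _ mI s _ _ Is
    int_f der _ G0 intG ub).
rewrite -derive1E (@differentiation_under_integral R _ (measurableTypeR R) mu f
  _ mI s _ _ Is int_f der _ G0 intG ub).
apply: eq_Rintegral => y /set_mem yI; rewrite partial1of2E.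
by have [_ ->] := isd _ _ (sub _ Is) yI.
Qed.

Lemma Rintegral_is_derive01 (F f : R -> R) :
  (forall t : R, t \in `[0, 1] -> is_derive t 1 F (f t)) ->
  {within `[0, 1], continuous f} ->
  \int[mu]_(t in `[0, 1]) f t = F 1 - F 0.
Proof.
move=> dF cf; rewrite /Rintegral (@continuous_FTC2 _ f F 0 1)//.
- have cF t : t \in `[0, 1] -> {for t, continuous F}.
    move=> /dF[dFt _]; apply: differentiable_continuous.
    exact/derivable1_diffP.
  split.
  + by move=> x xI; have [] := dF x (subset_itv_oo_cc xI).
  + by apply: cvg_at_right_filter; apply: cF; rewrite in_itv/= lexx ler01.
  + by apply: cvg_at_left_filter; apply: cF; rewrite in_itv/= lexx ler01.
- move=> x xI; rewrite derive1E.
  by have [_ ->] := dF x (subset_itv_oo_cc xI).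
Qed.

Implicit Types (A : 'I_3 -> E3 -> R) (O : set E3).

(** A field is given by its three components, because these carry the C1
    hypotheses. *)
Definition pairing A (x v : E3) : R := \sum_k A k x * v 0 k.

Definition segment_integral A (p q : E3) : R :=
  \int[mu]_(t in `[0, 1]) pairing A (p + t *: (q - p)) (q - p).

Definition closed_field O A := forall i j x, O x ->
  'D_(basis_vec R i) (A j) x = 'D_(basis_vec R j) (A i) x.

Lemma cvg_sum_ord (T : Type) (F : set_system T) (FF : Filter F) n
    (f : 'I_n -> T -> R) (l : 'I_n -> R) :
  (forall k, f k x @[x --> F] --> l k) ->
  \sum_k f k x @[x --> F] --> \sum_k l k.
Proof.
move=> fl; apply: (@cvg_big R^o); first exact: add_continuous.
by move=> k _; exact: fl.
Qed.

Lemma continuous_line2 (p a v : E3) :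
  continuous (fun z : R * R => p + z.2 *: (a + z.1 *: v)).
Proof.
move=> z; apply: cvgD; first exact: cvg_cst.
apply: cvgZ; first exact: cvg_snd.
apply: cvgD; first exact: cvg_cst.
by apply: cvgZ; [exact: cvg_fst|exact: cvg_cst].
Qed.

Section Ray.
Variables (O : set E3) (A : 'I_3 -> E3 -> R).
Hypothesis A_C1 : forall k, realC1 O (A k).
Hypothesis A_closed : closed_field O A.
Variables (p q v : E3).

Let w (s : R) : E3 := q - p + s *: v.
Let X (s t : R) : E3 := p + t *: w s.
Let dP (s t : R) : R := \sum_k
  ((\sum_j (t * v 0 j) * 'D_(basis_vec R j) (A k) (X s t)) * w s 0 k
    + A k (X s t) * v 0 k).

Let X_cont : continuous (fun z : R * R => X z.1 z.2).
Proof. exact: continuous_line2. Qed.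

Let A_cont k x : O x -> {for x, continuous (A k)}.
Proof. by move=> /(A_C1 k)[/differentiable_continuous]. Qed.

Let w_cont k : continuous (fun z : R * R => w z.1 0 k).
Proof.
move=> z; apply: (@continuous_comp _ _ _ (fun z : R * R => w z.1) (fun x : E3 => x 0 k)).
  apply: cvgD; first exact: cvg_cst.
  by apply: cvgZ; [exact: cvg_fst|exact: cvg_cst].
exact: coord_continuous.
Qed.

Let P_cont s : (forall t : R, t \in `[0, 1] -> O (X s t)) ->
  {within `[0, 1], continuous (fun t => pairing A (X s t) (w s))}.
Proof.
move=> OX; apply: continuous_in_subspaceT => t /set_mem tI.
apply: cvg_sum_ord => k; apply: cvgM; last exact: cvg_cst.
apply: (@continuous_comp _ _ _ (X s) (A k)); last exact/A_cont/OX.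
by apply: cvgD; [exact: cvg_cst|apply: cvgZ; [exact: cvg_id|exact: cvg_cst]].
Qed.

Let dP_cont (z : R * R) : O (X z.1 z.2) ->
  {for z, continuous (fun z : R * R => dP z.1 z.2)}.
Proof.
move=> OX; apply: cvg_sum_ord => k; apply: cvgD; apply: cvgM.
- apply: cvg_sum_ord => j; apply: cvgM.
    by apply: cvgM; [exact: cvg_snd|exact: cvg_cst].
  apply: (@continuous_comp _ _ _ (fun z : R * R => X z.1 z.2)
    ('D_(basis_vec R j) (A k))); first exact: X_cont.
  by have [_] := A_C1 k OX; apply.
- exact: w_cont.
- apply: (@continuous_comp _ _ _ (fun z : R * R => X z.1 z.2) (A k)).
    exact: X_cont.
  exact: A_cont.
- exact: cvg_cst.
Qed.

(** The same function [dP] is the derivative of the integrand in the direction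
   of the end point and, the field being closed, the derivative in the time
   [t] of [t * pairing A (X s t) v]. *)
Let is_derive_P s t : O (X s t) ->
  is_derive s 1 (fun s' => pairing A (X s' t) (w s')) (dP s t).
Proof.
move=> OX.
have -> : (fun s' => pairing A (X s' t) (w s')) =
    \sum_k (fun s' => A k (X s' t) * w s' 0 k).
  by apply/funext => s'; rewrite fct_sumE.
apply: is_derive_sum => k.
have dA : is_derive s 1 (fun s' => A k (X s' t))
    (\sum_j (t * v 0 j) * 'D_(basis_vec R j) (A k) (X s t)).
  have E s' : X s' t = (p + t *: (q - p)) + s' *: (t *: v).
    by rewrite /X /w scalerDr addrA !scalerA mulrC.
  have -> : (fun s' => A k (X s' t)) =
    fun s' => A k ((p + t *: (q - p)) + s' *: (t *: v)).
    by apply/funext => s'; rewrite E.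
  move: OX; rewrite E => /(A_C1 k)[dA _].
  have := is_derive_line dA; rewrite derive_rowE//.
  congr (is_derive _ _ _ _); apply: eq_bigr => j _.
  by rewrite mxE.
have dw : is_derive s 1 (fun s' => w s' 0 k) (v 0 k).
  have -> : (fun s' => w s' 0 k) = (fun s' => (q - p) 0 k + s' * v 0 k).
    by apply/funext => s'; rewrite !mxE.
  have := is_deriveD (is_derive_cst ((q - p) 0 k) s (1:R))
    (is_deriveM (is_derive_id s (1:R)) (is_derive_cst (v 0 k) s 1)).
  congr (is_derive _ _ _ _).
  by rewrite scaler0 !add0r [_%:A]mulr1.
have := is_deriveM dA dw.
congr (is_derive _ _ _ _).
by rewrite /GRing.scale/= addrC mulrC.
Qed.

Let is_derive_Q s t : O (X s t) ->
  is_derive t 1 (fun t' => t' * pairing A (X s t') v) (dP s t).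
Proof.
move=> OX.
have dS : is_derive t 1 (fun t' => pairing A (X s t') v)
   (\sum_k v 0 k * (\sum_j w s 0 j * 'D_(basis_vec R j) (A k) (X s t))).
  have -> : (fun t' => pairing A (X s t') v) =
      \sum_k (fun t' => A k (X s t') * v 0 k).
    by apply/funext => s'; rewrite fct_sumE.
  apply: is_derive_sum => k.
  have [dA _] := A_C1 k OX.
  have := is_derive_line dA; rewrite derive_rowE// => H.
  have := is_deriveM H (is_derive_cst (v 0 k) t 1).
  congr (is_derive _ _ _ _).
  by rewrite scaler0 add0r.
have := is_deriveM (is_derive_id t (1:R)) dS.
congr (is_derive _ _ _ _).
rewrite /dP big_split/= /GRing.scale/= mulr1; congr (_ + _).
rewrite mulr_sumr [RHS](eq_bigr (fun k => \sum_j t * v 0 j *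
  'D_(basis_vec R j) (A k) (X s t) * w s 0 k)); last first.
  by move=> k _; rewrite mulr_suml.
rewrite exchange_big/=.
apply: eq_bigr => j _; rewrite !mulr_sumr; apply: eq_bigr => k _.
by rewrite A_closed//; ring.
Qed.

(** Moving the end point of a segment changes the integral at the rate at which
    the field acts on the velocity of the end point: after differentiation
    under the integral sign, the integrand is an exact derivative in the time
    along the segment, by closedness. *)
Lemma is_derive_segment_integral (s d : R) : 0 < d ->
  (forall s' t : R, s' \in `[s - d, s + d] -> t \in `[0, 1] ->
     O (p + t *: (q - p + s' *: v))) ->
  is_derive s 1 (fun s' => segment_integral A p (q + s' *: v))
    (pairing A (q + s *: v) v).
Proof.
move=> d0 OX.
have sI : s \in `[s - d, s + d] by rewrite in_itv/= lerBlDr lerDl ltW.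
have -> : (fun s' => segment_integral A p (q + s' *: v)) =
    (fun s' => \int[mu]_(t in `[0, 1]) pairing A (X s' t) (w s')).
  by apply/funext => s'; apply: eq_Rintegral => t _; rewrite addrAC.
have -> : pairing A (q + s *: v) v = \int[mu]_(t in `[0, 1]) dP s t.
  have dQ (t : R) : t \in `[0, 1] ->
      is_derive t 1 (fun t' => t' * pairing A (X s t') v) (dP s t).
    by move=> tI; apply: is_derive_Q; exact: OX.
  have cP : {within `[0, 1], continuous (dP s)}.
    apply: continuous_in_subspaceT => t /set_mem tI.
    apply: (@continuous_comp _ _ _ (fun t => (s, t)) (fun z => dP z.1 z.2)).
      by apply: (@cvg_pair _ _ _ _ (nbhs s) (nbhs t)); [exact: cvg_cst|exact: cvg_id].
    by apply: dP_cont; exact: OX.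
  rewrite (Rintegral_is_derive01 dQ cP).
  by rewrite mul0r subr0 mul1r /X scale1r /w addrA addrCA subrr addr0.
apply: (is_derive_integral01 d0) => [s' s'I|s' t s'I tI|].
- by apply: P_cont => t; exact: OX.
- by apply: is_derive_P; exact: OX.
- apply: continuous_in_subspaceT => z /set_mem[z1 z2].
  by apply: dP_cont; exact: OX.
Qed.

End Ray.

Lemma ball_convex (c p q : E3) (e t : R) : t \in `[0, 1] ->
  ball c e p -> ball c e q -> ball c e (p + t *: (q - p)).
Proof.
rewrite in_itv/= => /andP[t0 t1]; rewrite -!ball_normE/= => cp cq.
have -> : c - (p + t *: (q - p)) = (1 - t) *: (c - p) + t *: (c - q).
  by apply/rowP => i; rewrite !mxE; ring.
have t1' : 0 <= 1 - t by rewrite subr_ge0.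
rewrite (le_lt_trans (ler_normD _ _))// !normrZ (ger0_norm t0) (ger0_norm t1').
have [->|tn0] := eqVneq t 0; first by rewrite subr0 mul1r mul0r addr0.
have h1 : 0 <= (1 - t) * (e - `|c - p|) by rewrite mulr_ge0// subr_ge0 ltW.
have h2 : 0 < t * (e - `|c - q|).
  by rewrite mulr_gt0 ?subr_gt0// lt_neqAle eq_sym tn0.
lra.
Qed.

Section Potential.
Variables (O : set E3) (A : 'I_3 -> E3 -> R).
Hypothesis A_C1 : forall k, realC1 O (A k).
Hypothesis A_closed : closed_field O A.

Lemma is_derive_segment_integral_ball (c p q v : E3) (e s : R) :
  ball c e `<=` O -> ball c e p -> ball c e (q + s *: v) ->
  is_derive s 1 (fun s' => segment_integral A p (q + s' *: v))
    (pairing A (q + s *: v) v).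
Proof.
move=> cO cp cq.
have e0 : 0 < e.
  by move: cp; rewrite -ball_normE/=; exact: le_lt_trans.
have : \forall x \near s, ball c e (q + x *: v).
  have cs : {for s, continuous (fun x : R => q + x *: v)}.
    by apply: cvgD; [exact: cvg_cst|apply: cvgZ; [exact: cvg_id|exact: cvg_cst]].
  apply: cs; apply: open_nbhs_nbhs; split => //; exact: ball_open.
move=> /nbhs_ballP[d /= d0 dP].
apply: (@is_derive_segment_integral O A A_C1 A_closed p q v s (d / 2)).
  by rewrite divr_gt0.
move=> s' t s'I tI; apply: cO; rewrite addrAC; apply: ball_convex => //.
apply: dP; rewrite -ball_normE/= ltr_norml.
by move: s'I; rewrite in_itv/= => /andP[? ?]; apply/andP; split; lra.
Qed.

(** Stokes for a triangle: both sides have the same derivative when [r] runs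
    along the segment from [q] to [r]. Convexity of the ball keeps the whole
    triangle inside [O]. *)
Lemma segment_integral_triangle (c p q r : E3) (e : R) : ball c e `<=` O ->
  ball c e p -> ball c e q -> ball c e r ->
  segment_integral A p q + segment_integral A q r = segment_integral A p r.
Proof.
move=> cO cp cq cr.
have dF (s : R) : s \in `[0, 1] ->
    is_derive s 1 (fun s' => segment_integral A p (q + s' *: (r - q)))
      (pairing A (q + s *: (r - q)) (r - q)).
  by move=> sI; apply: is_derive_segment_integral_ball cO cp _; exact: ball_convex.
have cf : {within `[0, 1],
    continuous (fun s : R => pairing A (q + s *: (r - q)) (r - q))}.
  apply: continuous_in_subspaceT => s /set_mem sI.
  apply: cvg_sum_ord => k; apply: cvgM; last exact: cvg_cst.
  apply: (@continuous_comp _ _ _ (fun s : R => q + s *: (r - q)) (A k)).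
    by apply: cvgD; [exact: cvg_cst|apply: cvgZ; [exact: cvg_id|exact: cvg_cst]].
  apply: differentiable_continuous.
  by have [] := A_C1 k (cO _ (ball_convex sI cq cr)).
rewrite [X in _ + X](Rintegral_is_derive01 dF cf).
by rewrite scale0r addr0 scale1r (addrC q (r - q)) subrK addrC subrK.
Qed.

Lemma segment_integral_xx (p : E3) : segment_integral A p p = 0.
Proof.
rewrite /segment_integral/Rintegral integral0_eq// => x _.
by rewrite /pairing big1// => k _; rewrite subrr mxE mulr0.
Qed.

End Potential.

End LineIntegral.

(** * Differentiability from directional derivatives *)

Section Directional.
Variable R : realType.
Local Notation E3 := 'rV[R]_3.

Lemma coord_norm_le (x : E3) k : `|x 0 k| <= `|x|.
Proof.
by rewrite {2}/Num.norm/= mx_normrE; apply: (le_bigmax _ (fun ij => `|x ij.1 ij.2|) (0, k)).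
Qed.

(** The mean value theorem on the segment from [x] to [x + h] compares the
    increment of [f] with the value at [x] of the field, which is continuous. *)
Lemma differentiable_of_directional (O : set E3) (A : 'I_3 -> E3 -> R)
    (f : E3 -> R) (x : E3) : open O -> O x ->
  (forall k, {for x, continuous (A k)}) ->
  (forall y v, O y -> is_derive y v f (pairing A y v)) ->
  differentiable f x.
Proof.
move=> oO Ox cA df.
have lin : linear (pairing A x : E3 -> R).
  move=> a u v; rewrite /pairing scaler_sumr -big_split/=.
  by apply: eq_bigr => k _; rewrite !mxE /GRing.scale/=; ring.
pose Llin := GRing.isLinear.Build _ _ _ _ _ lin.
pose L : {linear E3 -> R} := HB.pack (pairing A x : E3 -> R) Llin.
have cL : continuous (L : E3 -> R).
  move=> y; apply: (@cvg_sum_ord R _ (nbhs y) _) => k; apply: cvgM; first exact: cvg_cst.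
  exact: coord_continuous.
have fL : f \o shift x = cst (f x) + (L : E3 -> R) +o_ (0 : E3) id.
  apply: eqaddoE; apply/eqaddoP => eps eps0.
  (* One third of [eps] for each of the three components. *)
  have : \forall y \near x, O y /\ forall k, `|A k y - A k x| <= eps / 3.
    have nA : \forall y \near x, forall k, `|A k y - A k x| <= eps / 3.
      apply: (@filter_forall _ _ (fun k y => is_true (`|A k y - A k x| <= eps / 3))
        (nbhs x)) => k.
      have /cvgrPdist_le/(_ (eps / 3)) := cA k.
      rewrite divr_gt0// => /(_ isT); apply: filterS => y.
      by rewrite distrC.
    by apply: filterI => //; exact: open_nbhs_nbhs.
  move=> /nbhs_ballP[d /= d0 dP].
  apply/nbhs_ballP; exists d => //= h; rewrite -ball_normE/= sub0r normrN => hd.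
  have near_seg c : c \in `[(0:R), 1] -> ball x d (x + c *: h).
    rewrite in_itv/= -ball_normE/= => /andP[c0 c1].
    rewrite opprD addNKr normrN normrZ (ger0_norm c0).
    by rewrite (le_lt_trans _ hd)// ler_piMl.
  have dg c : c \in `[(0:R), 1] ->
      is_derive c 1 (fun s : R => f (x + s *: h)) (pairing A (x + c *: h) h).
    by move=> cI; apply/is_derive_lineP/df; case: (dP _ (near_seg _ cI)).
  have cg : {within `[(0:R), 1], continuous (fun s : R => f (x + s *: h))}.
    by apply: derivable_within_continuous => c cI; have [] := dg c cI.
  have dg' (c : R) : c \in `]0, 1[ ->
      is_derive c 1 (fun s : R => f (x + s *: h)) (pairing A (x + c *: h) h).
    by move=> cI; apply: dg; exact: subset_itv_oo_cc.
  have [c cI] := MVT_segment (ler01 : (0:R) <= 1) dg' cg.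
  rewrite scale1r scale0r addr0 subr0 mulr1 => E.
  rewrite !fctE /= (addrC h) opprD addrA E /pairing -sumrB.
  rewrite (le_trans (ler_norm_sum _ _ _))//.
  apply: (@le_trans _ _ (\sum_(k < 3) eps / 3 * `|h|)).
    apply: ler_sum => k _; rewrite -mulrBl normrM ler_pM//.
      by have [_] := dP _ (near_seg _ cI); apply.
    exact: coord_norm_le.
  by rewrite sumr_const card_ord -mulrnAl -mulr_natr divfK.
by apply/diff_locallyP; rewrite (diff_unique cL fL).
Qed.

End Directional.

(** * Integrals of a closed field along continuous curves *)

Section Curves.
Variable R : realType.
Local Notation E3 := 'rV[R]_3.

(** A Lebesgue number argument: on a fine enough grid of the unit square, the
    corners of each cell are sent into one ball contained in [O]. *)
Lemma fine_grid_balls (O : set E3) (H : R * R -> E3) : open O ->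
  {within `[0, 1] `*` `[0, 1], continuous H} ->
  (forall s t : R, s \in `[0, 1] -> t \in `[0, 1] -> O (H (s, t))) ->
  exists N, forall n, (N <= n)%N -> forall s t : R, s \in `[0, 1] -> t \in `[0, 1] ->
    exists c e, ball c e `<=` O /\
      forall s' t' : R, s' \in `[0, 1] -> t' \in `[0, 1] ->
        `|s - s'| <= n.+1%:R^-1 -> `|t - t'| <= n.+1%:R^-1 ->
        ball c e (H (s', t')).
Proof.
move=> oO cH OH.
have cK : compact ([set` `[(0 : R), 1]] `*` [set` `[(0 : R), 1]]).
  by apply: compact_setX; exact: segment_compact.
move/compact_near_coveringP/near_covering_withinP : cK.
pose P (n : nat) (z : R * R) := exists c e, ball c e `<=` O /\
      forall s' t' : R, s' \in `[0, 1] -> t' \in `[0, 1] ->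
        `|z.1 - s'| <= n.+1%:R^-1 -> `|z.2 - t'| <= n.+1%:R^-1 ->
        ball c e (H (s', t')).
move=> /(_ nat \oo P); case.
- move=> z Kz.
  have /nbhs_ballP[e /= e0 eO] : nbhs (H z) O.
    by apply: open_nbhs_nbhs; split => //; case: z Kz => s t [/= sI tI]; exact: OH.
  have /subspace_continuousP/(_ z Kz) := cH.
  move=> /(_ _ (nbhsx_ballx (H z) e e0)).
  rewrite /within/= => /nbhs_ballP[d /= d0 dH].
  have d20 : 0 < d / 2 by rewrite divr_gt0.
  near=> w n => Kw.
  exists (H z), e; split=> // s' t' s'I t'I ws wt.
  apply: dH => //=.
  have nd : n.+1%:R^-1 < d / 2.
    by near: n; exact: (near_infty_natSinv_lt (PosNum d20)).
  have [zw1 zw2] : ball z (d / 2) w by near: w; exact: nbhsx_ballx.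
  have aux (a b c : R) : ball a (d / 2) b -> `|b - c| <= n.+1%:R^-1 -> ball a d c.
    rewrite -!ball_normE/= => ab bc.
    rewrite -(subrKA b) (le_lt_trans (ler_normD _ _))//.
    by rewrite [d]splitr ltrD// (le_lt_trans bc).
  by split; [exact: aux zw1 ws|exact: aux zw2 wt].
- move=> N _ NP; exists N => n Nn s t sI tI.
  exact: (NP n Nn (s, t)).
Unshelve. all: by end_near.
Qed.

Lemma grid_in01 n j : (j <= n.+1)%N -> (j%:R / n.+1%:R : R) \in `[0, 1].
Proof.
move=> jn; rewrite in_itv/= divr_ge0//= ler_pdivrMr//.
by rewrite mul1r ler_nat.
Qed.

Lemma grid_step n j : `|j%:R / n.+1%:R - j.+1%:R / n.+1%:R : R| <= n.+1%:R^-1.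
Proof.
rewrite -mulrBl -natr1 opprD addNKr mulN1r normrN ger0_norm//.
Qed.

Section CurveIntegral.
Variables (O : set E3) (A : 'I_3 -> E3 -> R).
Hypothesis oO : open O.
Hypothesis A_C1 : forall k, realC1 O (A k).
Hypothesis A_closed : closed_field O A.

Definition chord_sum (g : R -> E3) n :=
  \sum_(j < n) segment_integral A (g (j%:R / n%:R)) (g (j.+1%:R / n%:R)).

(** Row by row along a fine grid the chord sums of the homotopy do not change:
    by the triangle law the two ways around a cell have the same integral, and
    the vertical contributions telescope to the two sides of the square, on
    which the homotopy is constant. The last row is a constant path. *)
Lemma homotopy_chord_sum (g : R -> E3) (H : R * R -> E3) :
  {within `[0, 1] `*` `[0, 1], continuous H} ->
  (forall s t : R, s \in `[0, 1] -> t \in `[0, 1] -> O (H (s, t))) ->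
  (forall t : R, t \in `[0, 1] -> H (0, t) = g t /\ H (1, t) = g 0) ->
  (forall s : R, s \in `[0, 1] -> H (s, 0) = g 0 /\ H (s, 1) = g 0) ->
  exists N, forall n, (N <= n)%N -> chord_sum g n.+1 = 0.
Proof.
move=> cH OH Hs Ht; have [N NP] := fine_grid_balls oO cH OH.
exists N => n Nn.
pose x j : R := j%:R / n.+1%:R.
pose S i := \sum_(j < n.+1) segment_integral A (H (x i, x j)) (H (x i, x j.+1)).
have x0 : x 0 = 0 by rewrite /x mul0r.
have xn : x n.+1 = 1 by rewrite /x divff.
have cell i j : (i <= n)%N -> (j <= n)%N ->
    segment_integral A (H (x i, x j)) (H (x i, x j.+1)) =
    segment_integral A (H (x i.+1, x j)) (H (x i.+1, x j.+1)) +
    (segment_integral A (H (x i, x j)) (H (x i.+1, x j)) -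
     segment_integral A (H (x i, x j.+1)) (H (x i.+1, x j.+1))).
  move=> lin ljn.
  have i1 : x i \in `[0, 1] by apply: grid_in01; exact: leqW.
  have j1 : x j \in `[0, 1] by apply: grid_in01; exact: leqW.
  have i2 : x i.+1 \in `[0, 1] by exact: grid_in01.
  have j2 : x j.+1 \in `[0, 1] by exact: grid_in01.
  have [c [e [cO ce]]] := NP n Nn _ _ i1 j1.
  have z : `|x i - x i| <= n.+1%:R^-1 by rewrite subrr normr0 invr_ge0.
  have z' : `|x j - x j| <= n.+1%:R^-1 by rewrite subrr normr0 invr_ge0.
  have a := ce _ _ i1 j1 z z'.
  have b := ce _ _ i1 j2 z (grid_step _ _).
  have a' := ce _ _ i2 j1 (grid_step _ _) z'.
  have b' := ce _ _ i2 j2 (grid_step _ _) (grid_step _ _).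
  have T1 := segment_integral_triangle A_C1 A_closed cO a b b'.
  have T2 := segment_integral_triangle A_C1 A_closed cO a a' b'.
  by rewrite addrA [X in X - _]addrC T2 -T1 addrK.
have step i : (i <= n)%N -> S i = S i.+1.
  move=> lin; rewrite /S [LHS](eq_bigr (fun j : 'I_n.+1 =>
    segment_integral A (H (x i.+1, x j)) (H (x i.+1, x j.+1)) +
    (segment_integral A (H (x i, x j)) (H (x i.+1, x j)) -
     segment_integral A (H (x i, x j.+1)) (H (x i.+1, x j.+1))))); last first.
    by move=> j _; apply: cell => //; rewrite -ltnS.
  rewrite big_split/= [X in _ + X](_ : _ = 0) ?addr0//.
  rewrite -(big_mkord xpredT (fun j => segment_integral A (H (x i, x j)) (H (x i.+1, x j)) -
     segment_integral A (H (x i, x j.+1)) (H (x i.+1, x j.+1)))).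
  rewrite (telescope_sumr_eq (fun j => - segment_integral A (H (x i, x j)) (H (x i.+1, x j))))//.
    have xi : x i \in `[0, 1] by apply: grid_in01; exact: leqW.
    have xi1 : x i.+1 \in `[0, 1] by exact: grid_in01.
    rewrite x0 xn !(Ht _ xi).1 !(Ht _ xi).2 !(Ht _ xi1).1 !(Ht _ xi1).2.
    by rewrite !segment_integral_xx oppr0 subr0.
  by move=> j _; rewrite opprK addrC.
have S0 : chord_sum g n.+1 = S 0%N.
  apply: eq_bigr => j _; rewrite x0.
  by rewrite !(Hs _ (grid_in01 _)).1// ltnW.
have Sn : S n.+1 = 0.
  rewrite /S big1// => j _; rewrite xn !(Hs _ (grid_in01 _)).2 ?segment_integral_xx//.
  exact: ltnW.
clearbody S; rewrite S0 -Sn.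
suff Si i : (i <= n.+1)%N -> S 0%N = S i by exact: Si.
elim: i => [//|i IH lin]; rewrite -(step _ lin).
by apply: IH; exact: ltnW.
Qed.

(** A merely continuous curve has no velocity, so the integral along it is read
    off inscribed polygons; for a closed field their sums are eventually
    constant, which replaces a limit. Dyadic subdivisions make concatenation
    exact, since the middle of the parameter interval is always a grid point.
    The parametrization is continuous on the whole line, so that concatenation
    can reparametrize it by clamping. *)
Definition has_curve_integral (p q : E3) (v : R) := exists g : R -> E3,
  [/\ continuous g, forall t : R, t \in `[0, 1] -> O (g t), g 0 = p, g 1 = q &
    exists m0, forall m, (m0 <= m)%N -> chord_sum g (2 ^ m) = v].

Lemma curve_integral_loop p v : simply_connected O -> has_curve_integral p p v -> v = 0.
Proof.
move=> sc [g [cg Og g0 g1 [m0 gm]]].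
have [||H [cH OH Hs Ht]] := sc g _ Og.
- exact: continuous_subspaceT.
- by rewrite g0 g1.
have [N NP] := homotopy_chord_sum cH OH Hs Ht.
rewrite -(gm (maxn m0 N.+1)) ?leq_maxl//.
have : (N < 2 ^ maxn m0 N.+1)%N.
  by rewrite (leq_trans _ (ltnW (ltn_expl _ _)))// leq_maxr.
by case: (2 ^ _)%N => // n Nn; exact: NP.
Qed.

Lemma curve_integral_segment c e p q : ball c e `<=` O -> ball c e p -> ball c e q ->
  has_curve_integral p q (segment_integral A p q).
Proof.
move=> cO cp cq; exists (fun t => p + t *: (q - p)); split.
- by move=> t; apply: cvgD; [exact: cvg_cst|apply: cvgZ; [exact: cvg_id|exact: cvg_cst]].
- by move=> t tI; apply: cO; exact: ball_convex.
- by rewrite scale0r addr0.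
- by rewrite scale1r addrC subrK.
exists 0%N => m _.
have : (0 < 2 ^ m)%N by rewrite expn_gt0.
case: (2 ^ m)%N => // n _.
rewrite /chord_sum.
pose x j : R := j%:R / n.+1%:R.
rewrite -(big_mkord xpredT (fun j => segment_integral A (p + x j *: (q - p)) (p + x j.+1 *: (q - p)))).
rewrite (telescope_sumr_eq (fun j => segment_integral A p (p + x j *: (q - p))))//.
  rewrite /x mul0r divff// scale0r addr0 scale1r segment_integral_xx subr0.
  by rewrite addrC subrK.
move=> j /andP[_ jn].
have bx i : (i <= n.+1)%N -> ball c e (p + x i *: (q - p)).
  by move=> lin; apply: ball_convex => //; exact: grid_in01.
have := segment_integral_triangle A_C1 A_closed cO cp (bx j (ltnW jn)) (bx _ jn).
by move=> <-; rewrite addrAC subrr add0r.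
Qed.

(** Both curves are frozen outside their own half of the interval, so that
    their sum minus the common point is continuous without any case analysis. *)
Lemma curve_integral_trans p q r v w :
  has_curve_integral p q v -> has_curve_integral q r w -> has_curve_integral p r (v + w).
Proof.
move=> [g1 [c1 O1 p1 q1 [m1 s1]]] [g2 [c2 O2 q2 r2 [m2 s2]]].
pose g (t : R) := g1 (Num.min (2 * t) 1) + g2 (Num.max (2 * t - 1) 0) - q.
have gl t : t <= 1 / 2 -> g t = g1 (2 * t).
  move=> th; rewrite /g min_l; last lra.
  by rewrite max_r ?q2 ?addrK//; lra.
have gr t : 1 / 2 <= t -> g t = g2 (2 * t - 1).
  move=> th; rewrite /g min_r; last lra.
  rewrite max_l; last lra.
  by rewrite q1 addrC addKr.
have c2t : continuous (fun t : R => 2 * t).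
  by move=> t; apply: cvgM; [exact: cvg_cst|exact: cvg_id].
have cg1 : continuous (fun t : R => g1 (Num.min (2 * t) 1)).
  move=> t; apply: (@continuous_comp _ _ _ (fun t : R => Num.min (2 * t) 1) g1).
    by apply: continuous_min; [exact: c2t|exact: cvg_cst].
  exact: c1.
have cg2 : continuous (fun t : R => g2 (Num.max (2 * t - 1) 0)).
  move=> t; apply: (@continuous_comp _ _ _ (fun t : R => Num.max (2 * t - 1) 0) g2).
    apply: continuous_max; last exact: cvg_cst.
    by apply: cvgB; [exact: c2t|exact: cvg_cst].
  exact: c2.
exists g; split.
- by move=> t; apply: cvgB; [apply: cvgD; [exact: cg1|exact: cg2]|exact: cvg_cst].
- move=> t; rewrite in_itv/= => /andP[t0 t1].
  have [th|/ltW th] := leP t (1 / 2).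
    by rewrite gl//; apply: O1; rewrite in_itv/=; apply/andP; split; lra.
  by rewrite gr//; apply: O2; rewrite in_itv/=; apply/andP; split; lra.
- by rewrite gl ?mulr0//; lra.
- by rewrite gr ?mulr1 -?r2; [congr g2|]; lra.
exists (maxn m1 m2).+1 => -[//|m]; rewrite ltnS geq_max => /andP[mm1 mm2].
rewrite -(s1 m)// -(s2 m)// expnS mul2n -addnn.
have : (0 < 2 ^ m)%N by rewrite expn_gt0.
case: (2 ^ m)%N => // n _.
rewrite /chord_sum big_split_ord/=.
have n0 : (n.+1%:R : R) != 0 by [].
have nn : ((n.+1 + n.+1)%:R : R) = 2 * n.+1%:R by rewrite natrD; ring.
have L j : (j <= n.+1)%N -> g (j%:R / (n.+1 + n.+1)%:R) = g1 (j%:R / n.+1%:R).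
  move=> jn; rewrite gl; last first.
    rewrite nn ler_pdivrMr ?mulr_gt0 ?ltr0n// mulrA div1r mulVf// mul1r.
    by rewrite ler_nat.
  by congr g1; rewrite nn; field.
have Rr j : g ((n.+1 + j)%:R / (n.+1 + n.+1)%:R) = g2 (j%:R / n.+1%:R).
  rewrite gr; last first.
    rewrite nn ler_pdivlMr ?mulr_gt0 ?ltr0n// mulrA div1r mulVf// mul1r.
    by rewrite ler_nat leq_addr.
  by congr g2; rewrite nn natrD; field.
congr (_ + _); apply: eq_bigr => j _.
  by rewrite !L// ltnW.
by rewrite -addnS !Rr.
Qed.

End CurveIntegral.
End Curves.

(** * Potentials on simply connected domains *)

Section PotentialExistence.
Variable R : realType.
Local Notation E3 := 'rV[R]_3.

(** The value of the potential at [x] is the integral along a curve from a base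
    point [x0] to [x]. Requiring also a curve back with the opposite integral
    spares the reversal of curves: two candidate values differ by the integral
    along a loop, which vanishes. Every point is reached because the set of
    reached points is open and closed in the connected set [O]. *)
Theorem closed_field_potential (O : set E3) (A : 'I_3 -> E3 -> R) :
  domain O -> simply_connected O -> (forall k, realC1 O (A k)) ->
  closed_field O A ->
  exists f : E3 -> R, forall x, O x -> differentiable f x /\
    forall v, 'D_v f x = pairing A x v.
Proof.
move=> [oO [x0 Ox0] cO] scO A_C1 A_closed.
pose Rel x v := has_curve_integral O A x0 x v /\ has_curve_integral O A x x0 (- v).
have ballO x : O x -> exists2 e, 0 < e & ball x e `<=` O.
  by move=> Ox; apply/nbhs_ballP/open_nbhs_nbhs.
have extend c e x y v : ball c e `<=` O -> ball c e x -> ball c e y ->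
    Rel x v -> Rel y (v + segment_integral A x y).
  move=> bO bx yb [r1 r2]; split.
    apply: curve_integral_trans r1 _.
    exact: (curve_integral_segment A_C1 A_closed bO bx yb).
  have -> : - (v + segment_integral A x y) = segment_integral A y x + (- v).
    have := segment_integral_triangle A_C1 A_closed bO bx yb bx.
    by rewrite segment_integral_xx => /eqP; rewrite addr_eq0 => /eqP->; rewrite opprB.
  apply: curve_integral_trans r2.
  exact: (curve_integral_segment A_C1 A_closed bO yb bx).
have uniq x v w : Rel x v -> Rel x w -> v = w.
  move=> [v1 _] [_ w2]; apply/eqP; rewrite -subr_eq0; apply/eqP.
  exact: (curve_integral_loop oO A_C1 A_closed scO (curve_integral_trans v1 w2)).
pose S := [set x | O x /\ exists v, Rel x v].
have SE c e x y : ball c e `<=` O -> ball c e x -> ball c e y -> S x -> S y.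
  move=> bO bx yb [_ [v Rv]]; split; first exact: bO.
  by exists (v + segment_integral A x y); exact: extend bO bx yb Rv.
have SO : S = O.
  apply: cO.
  - exists x0; split => //; exists 0.
    have [e e0 bO] := ballO _ Ox0.
    have b0 := ballxx x0 e0.
    have := curve_integral_segment A_C1 A_closed bO b0 b0.
    by rewrite segment_integral_xx /Rel oppr0.
  - exists S; last by rewrite setIidr// => x [].
    rewrite openE => x Sx; have [Ox _] := Sx; have [e e0 bO] := ballO _ Ox.
    apply/nbhs_ballP; exists e => // y xy.
    exact: SE bO (ballxx x e0) xy Sx.
  - exists (~` (O `\` S)).
      apply: open_closedC; rewrite openE => x [Ox nSx].
      have [e e0 bO] := ballO _ Ox.
      apply/nbhs_ballP; exists e => // y xy; split; first exact: bO.
      by apply: contra_not nSx; exact: SE bO xy (ballxx x e0).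
    apply/seteqP; split => x.
      by move=> Sx; split; [case: Sx|case].
    by move=> [Ox nx]; apply: contrapT => nS; apply: nx.
pose f x := xget 0 [set v | Rel x v].
have fR x : O x -> Rel x (f x).
  by rewrite -SO => -[_ exv]; exact: (@xgetPex _ 0 [set v | Rel x v]).
have fS x y e : ball x e `<=` O -> 0 < e -> ball x e y -> f y = f x + segment_integral A x y.
  move=> bO e0 xy; have xx := ballxx x e0.
  apply: uniq (fR _ (bO _ xy)) _.
  exact: extend bO xx xy (fR _ (bO _ xx)).
have df y v : O y -> is_derive y v f (pairing A y v).
  move=> Oy; have [e e0 bO] := ballO _ Oy; have yy := ballxx y e0.
  have E : y + 0 *: v = y by rewrite scale0r addr0.
  have yy0 : ball y e (y + 0 *: v) by rewrite E.
  have := is_derive_segment_integral_ball A_C1 A_closed bO yy yy0.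
  rewrite E => dseg.
  suff : is_derive (y + 0 *: v) v f (pairing A y v) by rewrite E.
  apply/is_derive_lineP.
  have := is_deriveD (is_derive_cst (f y) (0:R) 1) dseg.
  rewrite add0r; apply: near_eq_is_derive.
  have cs : {for (0:R), continuous (fun s : R => y + s *: v)}.
    by apply: cvgD; [exact: cvg_cst|apply: cvgZ; [exact: cvg_id|exact: cvg_cst]].
  have nb : \forall s \near (0:R), ball y e (y + s *: v).
    by apply: cs; rewrite /= E; exact: nbhsx_ballx.
  apply: (filterS _ nb) => s ys.
  exact: esym (fS _ _ _ bO e0 ys).
exists f => x Ox; split.
  apply: (differentiable_of_directional oO Ox _ df) => k.
  by apply: differentiable_continuous; have [] := A_C1 k _ Ox.
by move=> v; have [] := df x v Ox.
Qed.

End PotentialExistence.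

(** * Calculus of continuously differentiable real functions *)

Section RealC1.
Variable R : realType.
Local Notation E3 := 'rV[R]_3.
Variable O : set E3.
Hypothesis oO : open O.
Implicit Types f g : E3 -> R.

(** It is enough to know the partial derivatives on the open set [O]: they then
    agree with [df] near each of its points. *)
Lemma realC1_intro f (df : 'I_3 -> E3 -> R) :
  (forall x, O x -> differentiable f x) ->
  (forall k x, O x -> 'D_(basis_vec R k) f x = df k x) ->
  (forall k x, O x -> {for x, continuous (df k)}) -> realC1 O f.
Proof.
move=> d e c x Ox; split; first exact: d.
move=> k; rewrite /prop_for /continuous_at e//.
have nO : nbhs x O by exact: open_nbhs_nbhs.
have E : {near x, df k =1 'D_(basis_vec R k) f}.
  by apply: (filterS _ nO) => y Oy /=; rewrite e.
exact: cvg_trans (near_eq_cvg E) (c k x Ox).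
Qed.

Lemma realC1_cont f x : realC1 O f -> O x -> {for x, continuous f}.
Proof. by move=> fC /fC[/differentiable_continuous]. Qed.

Lemma realC1_derivable f x v : realC1 O f -> O x -> derivable f x v.
Proof. by move=> fC /fC[/diff_derivable]. Qed.

(** Differentiability of [g] is recovered from its directional derivatives,
    which are those of [f]. *)
Lemma eq_realC1 f g : (forall x, O x -> f x = g x) -> realC1 O f -> realC1 O g.
Proof.
move=> fg fC.
have nfg x : O x -> \forall y \near x, f y = g y.
  move=> Ox; have nO : nbhs x O by exact: open_nbhs_nbhs.
  by apply: (filterS _ nO) => y /fg.
apply: (realC1_intro (df := fun k => 'D_(basis_vec R k) f)).
- move=> x Ox.
  apply: (differentiable_of_directional (A := fun k => 'D_(basis_vec R k) f) oO Ox).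
    by move=> k; have [_] := fC _ Ox.
  move=> y v Oy; apply: (near_eq_is_derive (nfg _ Oy)).
  have [df _] := fC _ Oy.
  have := derivableP (@diff_derivable _ _ _ f y v df); rewrite derive_rowE// /pairing.
  by congr is_derive; apply: eq_bigr => k _; rewrite mulrC.
- by move=> k x Ox; rewrite (near_eq_derive _ (nfg _ Ox)).
- by move=> k x /fC[].
Qed.

Lemma realC1D f g : realC1 O f -> realC1 O g -> realC1 O (fun x => f x + g x).
Proof.
move=> fC gC.
apply: (realC1_intro (df := fun k x => 'D_(basis_vec R k) f x + 'D_(basis_vec R k) g x)).
- by move=> x Ox; have [? _] := fC _ Ox; have [? _] := gC _ Ox; exact: differentiableD.
- by move=> k x Ox; apply: deriveD; exact: realC1_derivable.
- move=> k x Ox; have [_ cf] := fC _ Ox; have [_ cg] := gC _ Ox.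
  exact: continuousD (cf k) (cg k).
Qed.

Lemma realC1M f g : realC1 O f -> realC1 O g -> realC1 O (fun x => f x * g x).
Proof.
move=> fC gC.
apply: (realC1_intro (df := fun k x => f x * 'D_(basis_vec R k) g x
   + g x * 'D_(basis_vec R k) f x)).
- by move=> x Ox; have [? _] := fC _ Ox; have [? _] := gC _ Ox; exact: differentiableM.
- by move=> k x Ox; apply: deriveM; exact: realC1_derivable.
- move=> k x Ox; have [_ cf] := fC _ Ox; have [_ cg] := gC _ Ox.
  apply: continuousD.
    exact: continuousM (realC1_cont fC Ox) (cg k).
  exact: continuousM (realC1_cont gC Ox) (cf k).
Qed.

Lemma realC1N f : realC1 O f -> realC1 O (fun x => - f x).
Proof.
move=> fC; apply: (realC1_intro (df := fun k x => - 'D_(basis_vec R k) f x)).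
- by move=> x Ox; have [? _] := fC _ Ox; exact: differentiableN.
- by move=> k x Ox; apply: deriveN; exact: realC1_derivable.
- by move=> k x Ox; have [_ cf] := fC _ Ox; exact: continuousN (cf k).
Qed.

Lemma derive_comp_real (phi : R -> R) (d : R) f x v :
  is_derive (f x) 1 phi d -> differentiable f x ->
  differentiable (fun y => phi (f y)) x /\
  'D_v (fun y => phi (f y)) x = d * 'D_v f x.
Proof.
move=> [dphi phiE] df; have dphi' := (derivable1_diffP _ _).1 dphi.
have dc : differentiable (phi \o f) x by exact: differentiable_comp.
split; first exact: dc.
rewrite (deriveE _ dc) diff_comp//= (deriv1E dphi) (deriveE _ df) derive1E phiE.
by rewrite mulrC.
Qed.

Lemma realC1_comp (phi dphi : R -> R) f : realC1 O f ->
  (forall x, O x -> is_derive (f x) 1 phi (dphi (f x))) ->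
  (forall x, O x -> {for f x, continuous dphi}) ->
  realC1 O (fun x => phi (f x)).
Proof.
move=> fC phiD dphiC.
apply: (realC1_intro (df := fun k x => dphi (f x) * 'D_(basis_vec R k) f x)).
- by move=> x Ox; have [df _] := fC _ Ox; have [] := derive_comp_real 0 (phiD _ Ox) df.
- by move=> k x Ox; have [df _] := fC _ Ox;
    have [] := derive_comp_real (basis_vec R k) (phiD _ Ox) df.
- move=> k x Ox; have [_ cf] := fC _ Ox; apply: (continuousM _ (cf k)).
  apply: (@continuous_comp _ _ _ f dphi); last exact: dphiC.
  exact: realC1_cont.
Qed.

Lemma realC1V f : realC1 O f -> (forall x, O x -> f x != 0) ->
  realC1 O (fun x => (f x)^-1).
Proof.
move=> fC f0; apply: (realC1_comp (phi := fun y => y^-1) (dphi := fun y => - (y ^- 2)) fC).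
  move=> x Ox; have := is_deriveV (f0 x Ox) (is_derive_id (f x) (1:R)).
  by congr is_derive; rewrite [_%:A]mulr1.
move=> x Ox; apply: cvgN; apply: cvgV; first by rewrite expf_neq0// f0.
exact: exprn_continuous.
Qed.

Lemma realC1_cst (c : R) : realC1 O (fun=> c).
Proof.
apply: (realC1_intro (df := fun _ _ => 0)) => [x _|k x _|k x _].
- exact: differentiable_cst.
- exact: derive_cst.
- exact: cst_continuous.
Qed.

End RealC1.

(** * Calculus of continuously differentiable complex functions *)

Section ComplexC1.
Local Open Scope complex_scope.
Variable R : realType.
Local Notation E3 := 'rV[R]_3.
Local Notation Re := complex.Re.
Local Notation Im := complex.Im.

Lemma eq_Re_Im (z w : R[i]) : Re z = Re w -> Im z = Im w -> z = w.
Proof. by case: z w => [a b] [c d] /= -> ->. Qed.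
Lemma ReD (z w : R[i]) : Re (z + w) = Re z + Re w.
Proof. by case: z w => [a b] [c d]. Qed.
Lemma ImD (z w : R[i]) : Im (z + w) = Im z + Im w.
Proof. by case: z w => [a b] [c d]. Qed.
Lemma ReM (z w : R[i]) : Re (z * w) = Re z * Re w - Im z * Im w.
Proof. by case: z w => [a b] [c d]. Qed.
Lemma ImM (z w : R[i]) : Im (z * w) = Re z * Im w + Im z * Re w.
Proof. by case: z w => [a b] [c d]. Qed.
Lemma Re_mulD (a b c d : R[i]) : Re (a * b + c * d) =
  Re a * Re b - Im a * Im b + (Re c * Re d - Im c * Im d).
Proof. by rewrite ReD !ReM. Qed.
Lemma Im_mulD (a b c d : R[i]) : Im (a * b + c * d) =
  Re a * Im b + Im a * Re b + (Re c * Im d + Im c * Re d).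
Proof. by rewrite ImD !ImM. Qed.
Lemma ReN (z : R[i]) : Re (- z) = - Re z.
Proof. by case: z. Qed.
Lemma ImN (z : R[i]) : Im (- z) = - Im z.
Proof. by case: z. Qed.
Lemma ReV (z : R[i]) : Re z^-1 = Re z / (Re z ^+ 2 + Im z ^+ 2).
Proof. by case: z. Qed.
Lemma ImV (z : R[i]) : Im z^-1 = - (Im z / (Re z ^+ 2 + Im z ^+ 2)).
Proof. by case: z. Qed.
Lemma Re_cexp (z : R[i]) : Re (cexp z) = expR (Re z) * cos (Im z).
Proof. by rewrite /cexp ReM /= mul0r subr0. Qed.
Lemma Im_cexp (z : R[i]) : Im (cexp z) = expR (Re z) * sin (Im z).
Proof. by rewrite /cexp ImM /= mul0r addr0. Qed.

Lemma cexpN_cexp (z : R[i]) : cexp (- z) * cexp z = 1.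
Proof.
apply: eq_Re_Im; rewrite (ReM, ImM) !Re_cexp !Im_cexp ReN ImN cosN sinN expRN /=.
  transitivity ((expR (Re z))^-1 * expR (Re z) * (cos (Im z) ^+ 2 + sin (Im z) ^+ 2)).
    by ring.
  by rewrite cos2Dsin2 mulr1 mulVf// gt_eqF// expR_gt0.
by ring.
Qed.

Lemma cexp_neq0 (z : R[i]) : cexp z != 0.
Proof.
apply/eqP => z0; have := cexpN_cexp z.
by rewrite z0 mulr0 => /esym/eqP; rewrite oner_eq0.
Qed.

Variable O : set E3.
Hypothesis oO : open O.
Implicit Types f g : E3 -> R[i].

Lemma eq_isC1 f g : (forall x, O x -> f x = g x) -> isC1 O f -> isC1 O g.
Proof.
by move=> fg [fr fi]; split; [apply: (eq_realC1 oO _ fr)|apply: (eq_realC1 oO _ fi)];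
  move=> x Ox; rewrite fg.
Qed.

Lemma eq_partial f g k x : O x -> (forall x, O x -> f x = g x) ->
  partial k f x = partial k g x.
Proof.
move=> Ox fg; have nO : nbhs x O by exact: open_nbhs_nbhs.
by rewrite /partial; congr (_ +i* _); apply: near_eq_derive;
  apply: (filterS _ nO) => y Oy; rewrite fg.
Qed.

Lemma isC1D f g : isC1 O f -> isC1 O g -> isC1 O (fun x => f x + g x).
Proof.
move=> [fr fi] [gr gi]; split.
  by apply: (eq_realC1 oO _ (realC1D oO fr gr)) => x _; rewrite ReD.
by apply: (eq_realC1 oO _ (realC1D oO fi gi)) => x _; rewrite ImD.
Qed.

Lemma isC1N f : isC1 O f -> isC1 O (fun x => - f x).
Proof.
move=> [fr fi]; split.
  by apply: (eq_realC1 oO _ (realC1N oO fr)) => x _; rewrite ReN.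
by apply: (eq_realC1 oO _ (realC1N oO fi)) => x _; rewrite ImN.
Qed.

Lemma isC1M f g : isC1 O f -> isC1 O g -> isC1 O (fun x => f x * g x).
Proof.
move=> [fr fi] [gr gi]; split.
  apply: (eq_realC1 oO _ (realC1D oO (realC1M oO fr gr)
    (realC1N oO (realC1M oO fi gi)))) => x _.
  by rewrite ReM.
apply: (eq_realC1 oO _ (realC1D oO (realC1M oO fr gi) (realC1M oO fi gr))) => x _.
by rewrite ImM.
Qed.

Lemma isC1V f : isC1 O f -> (forall x, O x -> f x != 0) ->
  isC1 O (fun x => (f x)^-1).
Proof.
move=> [fr fi] f0.
have n0 x : O x -> Re (f x) * Re (f x) + Im (f x) * Im (f x) != 0.
  move=> Ox; rewrite -!expr2 paddr_eq0 ?sqr_ge0// !sqrf_eq0.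
  by apply: contra (f0 x Ox) => /andP[/eqP a /eqP b]; apply/eqP/eq_Re_Im.
have nC := realC1V oO (realC1D oO (realC1M oO fr fr) (realC1M oO fi fi)) n0.
split.
  apply: (eq_realC1 oO _ (realC1M oO fr nC)) => x _.
  by rewrite ReV !expr2.
apply: (eq_realC1 oO _ (realC1N oO (realC1M oO fi nC))) => x _.
by rewrite ImV !expr2.
Qed.

Lemma realC1_expR (f : E3 -> R) : realC1 O f -> realC1 O (fun x => expR (f x)).
Proof.
move=> fC; apply: (realC1_comp oO fC (dphi := expR)) => // x _.
exact: continuous_expR.
Qed.
Lemma realC1_cos (f : E3 -> R) : realC1 O f -> realC1 O (fun x => cos (f x)).
Proof.
move=> fC; apply: (realC1_comp oO fC (dphi := fun y => - sin y)) => x _.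
apply: continuousN; exact: continuous_sin.
Qed.
Lemma realC1_sin (f : E3 -> R) : realC1 O f -> realC1 O (fun x => sin (f x)).
Proof.
move=> fC; apply: (realC1_comp oO fC (dphi := cos)) => x _.
exact: continuous_cos.
Qed.

Lemma isC1_cexp f : isC1 O f -> isC1 O (fun x => cexp (f x)).
Proof.
move=> [fr fi]; split.
  apply: (eq_realC1 oO _ (realC1M oO (realC1_expR fr) (realC1_cos fi))) => x _.
  by rewrite Re_cexp.
apply: (eq_realC1 oO _ (realC1M oO (realC1_expR fr) (realC1_sin fi))) => x _.
by rewrite Im_cexp.
Qed.

Lemma partialD f g k x : isC1 O f -> isC1 O g -> O x ->
  partial k (fun y => f y + g y) x = partial k f x + partial k g x.
Proof.
move=> [fr fi] [gr gi] Ox; apply: eq_Re_Im; rewrite ?ReD ?ImD /=.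
  have -> : (fun y => Re (f y + g y)) = (fun y => Re (f y)) + (fun y => Re (g y)).
    by apply/funext => y; rewrite ReD.
  by rewrite deriveD//; apply: realC1_derivable Ox.
have -> : (fun y => Im (f y + g y)) = (fun y => Im (f y)) + (fun y => Im (g y)).
  by apply/funext => y; rewrite ImD.
by rewrite deriveD//; apply: realC1_derivable Ox.
Qed.

Lemma partialN f k x : isC1 O f -> O x ->
  partial k (fun y => - f y) x = - partial k f x.
Proof.
move=> [fr fi] Ox; apply: eq_Re_Im; rewrite ?ReN ?ImN /=.
  have -> : (fun y => Re (- f y)) = - (fun y => Re (f y)).
    by apply/funext => y; rewrite ReN.
  by rewrite deriveN//; apply: realC1_derivable Ox.
have -> : (fun y => Im (- f y)) = - (fun y => Im (f y)).
  by apply/funext => y; rewrite ImN.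
by rewrite deriveN//; apply: realC1_derivable Ox.
Qed.

Lemma partialM f g k x : isC1 O f -> isC1 O g -> O x ->
  partial k (fun y => f y * g y) x = partial k f x * g x + f x * partial k g x.
Proof.
move=> [fr fi] [gr gi] Ox.
have der (h : E3 -> R) : realC1 O h -> derivable h x (basis_vec R k).
  by move=> hC; exact: realC1_derivable hC Ox.
have dfr := der _ fr; have dfi := der _ fi.
have dgr := der _ gr; have dgi := der _ gi.
apply: eq_Re_Im; rewrite [LHS]/=.
  have -> : (fun y => Re (f y * g y)) =
    (fun y => Re (f y)) * (fun y => Re (g y)) - (fun y => Im (f y)) * (fun y => Im (g y)).
    by apply/funext => y; rewrite ReM.
  rewrite [RHS]Re_mulD [RHS]/=.
  rewrite (deriveB (derivableM dfr dgr) (derivableM dfi dgi)).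
  rewrite (deriveM dfr dgr) (deriveM dfi dgi) /GRing.scale/=.
  move: ('D_(basis_vec R k) (fun y => Re (f y)) x)
    ('D_(basis_vec R k) (fun y => Im (f y)) x)
    ('D_(basis_vec R k) (fun y => Re (g y)) x)
    ('D_(basis_vec R k) (fun y => Im (g y)) x)
    (Re (f x)) (Im (f x)) (Re (g x)) (Im (g x)) => *; ring.
have -> : (fun y => Im (f y * g y)) =
    (fun y => Re (f y)) * (fun y => Im (g y)) + (fun y => Im (f y)) * (fun y => Re (g y)).
  by apply/funext => y; rewrite ImM.
rewrite [RHS]Im_mulD [RHS]/=.
rewrite (deriveD (derivableM dfr dgi) (derivableM dfi dgr)).
rewrite (deriveM dfr dgi) (deriveM dfi dgr) /GRing.scale/=.
move: ('D_(basis_vec R k) (fun y => Re (f y)) x)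
  ('D_(basis_vec R k) (fun y => Im (f y)) x)
  ('D_(basis_vec R k) (fun y => Re (g y)) x)
  ('D_(basis_vec R k) (fun y => Im (g y)) x)
  (Re (f x)) (Im (f x)) (Re (g x)) (Im (g x)) => *; ring.
Qed.

Lemma partial_cexp f k x : isC1 O f -> O x ->
  partial k (fun y => cexp (f y)) x = partial k f x * cexp (f x).
Proof.
move=> [fr fi] Ox.
have [dfr _] := fr x Ox; have [dfi _] := fi x Ox.
have der (h : E3 -> R) : differentiable h x -> derivable h x (basis_vec R k).
  by move=> /diff_derivable.
have [de deE] := derive_comp_real (basis_vec R k) (is_derive_expR (Re (f x))) dfr.
have [dc dcE] := derive_comp_real (basis_vec R k) (is_derive_cos (Im (f x))) dfi.
have [ds dsE] := derive_comp_real (basis_vec R k) (is_derive_sin (Im (f x))) dfi.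
apply: eq_Re_Im; rewrite (ReM, ImM) Re_cexp Im_cexp /=.
  have -> : (fun y => Re (cexp (f y))) =
      (fun y => expR (Re (f y))) * (fun y => cos (Im (f y))).
    by apply/funext => y; rewrite Re_cexp.
  rewrite (deriveM (der _ de) (der _ dc)).
  by rewrite deE dcE /GRing.scale/=; ring.
have -> : (fun y => Im (cexp (f y))) =
    (fun y => expR (Re (f y))) * (fun y => sin (Im (f y))).
  by apply/funext => y; rewrite Im_cexp.
rewrite (deriveM (der _ de) (der _ ds)).
by rewrite deE dsE /GRing.scale/=; ring.
Qed.

Lemma partial_cst (c : R[i]) k x : partial k (fun=> c) x = 0.
Proof. by rewrite /partial !derive_cst. Qed.

(** Obtained by differentiating the constant product of [f] and its inverse. *)
Lemma partialV f k x : isC1 O f -> (forall x, O x -> f x != 0) -> O x ->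
  partial k (fun y => (f y)^-1) x = - (partial k f x / f x ^+ 2).
Proof.
move=> fC f0 Ox; have fx := f0 x Ox.
have : partial k (fun y => (f y)^-1 * f y) x = 0.
  rewrite -[RHS](partial_cst 1 k x); apply: eq_partial => // y Oy.
  by rewrite mulVf// f0.
rewrite partialM//; last exact: isC1V.
move=> /eqP; rewrite addr_eq0 => /eqP E.
apply: (mulIf fx); rewrite E; field; exact: fx.
Qed.

End ComplexC1.

(** * Components of biquaternions and of the Dirac operator *)

Section Quat.
Variable K : comNzRingType.
Implicit Types p q : quat K.

Lemma eq_quat p q : q0 p = q0 q -> q1 p = q1 q -> q2 p = q2 q -> q3 p = q3 q ->
  p = q.
Proof. by case: p q => [a b c d] [a' b' c' d'] /= -> -> -> ->. Qed.

Lemma mul_vector p q : q0 p = 0 -> q0 q = 0 -> p * q =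
  Quat (- (q1 p * q1 q + q2 p * q2 q + q3 p * q3 q))
    (q2 p * q3 q - q3 p * q2 q) (q3 p * q1 q - q1 p * q3 q)
    (q1 p * q2 q - q2 p * q1 q).
Proof.
by case: p q => [a b c d] [a' b' c' d'] /= -> ->; apply: eq_quat => /=; ring.
Qed.

(** The terms of the Dirac operator on a vector field: minus the divergence as
    scalar part, the curl as vector part. *)
Lemma dirac_vector (a b c a' b' c' a'' b'' c'' : K) :
  qi * Quat 0 a b c + qj * Quat 0 a' b' c' + qk * Quat 0 a'' b'' c'' =
  Quat (- (a + b' + c'')) (c' - b'') (a'' - c) (b - a').
Proof. by apply: eq_quat => /=; ring. Qed.

Lemma basis_combination (a b c : K) : a *: qi + b *: qj + c *: qk = Quat 0 a b c.
Proof. by apply: eq_quat => /=; ring. Qed.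

Definition qcoord (k : 'I_3) q : K :=
  match val k with 0%N => q1 q | 1%N => q2 q | _ => q3 q end.

Lemma qcoordZ k (c : K) q : qcoord k (c *: q) = c * qcoord k q.
Proof. by case: k => [[|[|k]]]. Qed.

End Quat.

Section Fields.
Local Open Scope complex_scope.
Variable R : realType.
Local Notation E3 := 'rV[R]_3.
Local Notation d i j F := (partial i (fun y => qcoord j (F y))).
Implicit Types (F : E3 -> quat R[i]) (f : E3 -> R[i]).

Lemma gradE f x :
  grad f x = Quat 0 (partial 0 f x) (partial 1 f x) (partial 2%:R f x).
Proof. exact: basis_combination. Qed.

Lemma ord3_ind (P : 'I_3 -> Prop) : P 0 -> P 1 -> P 2%:R -> forall k, P k.
Proof.
move=> P0 P1 P2 [[|[|[|]]]]// k3.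
- by rewrite (_ : Ordinal k3 = 0)//; exact: val_inj.
- by rewrite (_ : Ordinal k3 = 1)//; exact: val_inj.
- by rewrite (_ : Ordinal k3 = 2%:R)//; exact: val_inj.
Qed.

Variable O : set E3.
Hypothesis oO : open O.

Lemma DopE F x : vectorial O F -> O x -> Dop F x =
  Quat (- (d 0 0 F x + d 1 1 F x + d 2%:R 2%:R F x))
    (d 1 2%:R F x - d 2%:R 1 F x) (d 2%:R 0 F x - d 0 2%:R F x)
    (d 0 1 F x - d 1 0 F x).
Proof.
move=> vF Ox.
have p0 k : partial k (fun y => q0 (F y)) x = 0.
  by rewrite (eq_partial oO k Ox vF) partial_cst.
by rewrite /Dop /qpartial !p0 dirac_vector.
Qed.

Lemma qisC1P F : vectorial O F ->
  (forall k, isC1 O (fun x => qcoord k (F x))) <-> qisC1 O F.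
Proof.
move=> vF; split=> [FC|[_ F1 F2 F3]]; last first.
  by apply: ord3_ind; [exact: F1|exact: F2|exact: F3].
split; [|exact: (FC 0)|exact: (FC 1)|exact: (FC 2%:R)].
apply: (eq_isC1 oO (f := fun=> 0)) => [x Ox|]; first by rewrite vF.
by split; exact: (realC1_cst oO 0).
Qed.

Lemma pairing_basis (A : 'I_3 -> E3 -> R) x k : pairing A x (basis_vec R k) = A k x.
Proof.
rewrite /pairing (bigD1 k)//= big1 ?addr0 => [|j jk]; rewrite mxE !eqxx/=.
  by rewrite mulr1.
by rewrite (negbTE jk) mulr0.
Qed.

Lemma partial_scale f F i j x : isC1 O f ->
  (forall k, isC1 O (fun x => qcoord k (F x))) -> O x ->
  d i j (fun y => f y *: F y) x =
    partial i f x * qcoord j (F x) + f x * d i j F x.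
Proof.
move=> fC FC Ox; rewrite -(partialM i fC (FC j) Ox).
by congr (partial i _ x); apply/funext => y; rewrite qcoordZ.
Qed.

Lemma scale_isC1 f F : isC1 O f ->
  (forall k, isC1 O (fun x => qcoord k (F x))) ->
  forall k, isC1 O (fun x => qcoord k (f x *: F x)).
Proof.
move=> fC FC k; apply: (eq_isC1 oO _ (isC1M oO fC (FC k))) => x _.
by rewrite qcoordZ.
Qed.

(** The real and imaginary parts are closed real fields with separate
    potentials. *)
Theorem curl_free_gradient F : domain O -> simply_connected O ->
  vectorial O F -> (forall k, isC1 O (fun x => qcoord k (F x))) ->
  (forall i j x, O x -> d i j F x = d j i F x) ->
  exists Psi : E3 -> R[i], isC2 O Psi /\ forall x, O x -> grad Psi x = F x.
Proof.
move=> dO scO vF FC curl.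
have [a aP] : exists f : E3 -> R, forall x, O x -> differentiable f x /\
    forall v, 'D_v f x = pairing (fun k x => complex.Re (qcoord k (F x))) x v.
  apply: closed_field_potential => //; first by move=> k; case: (FC k).
  by move=> i j x Ox; have := congr1 (@complex.Re R) (curl i j x Ox).
have [b bP] : exists f : E3 -> R, forall x, O x -> differentiable f x /\
    forall v, 'D_v f x = pairing (fun k x => complex.Im (qcoord k (F x))) x v.
  apply: closed_field_potential => //; first by move=> k; case: (FC k).
  by move=> i j x Ox; have := congr1 (@complex.Im R) (curl i j x Ox).
pose Psi x := a x +i* b x.
have pE k x : O x -> partial k Psi x = qcoord k (F x).
  move=> Ox; apply: eq_Re_Im => /=.
    by have [_ ->] := aP x Ox; rewrite pairing_basis.
  by have [_ ->] := bP x Ox; rewrite pairing_basis.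
exists Psi; split; last first.
  by move=> x Ox; rewrite gradE !pE//; apply: eq_quat => //=; rewrite vF.
split; last first.
  by move=> k; apply: (eq_isC1 oO _ (FC k)) => x Ox; rewrite pE.
split.
  apply: (realC1_intro oO (df := fun k x => complex.Re (qcoord k (F x)))).
  - by move=> x /aP[].
  - by move=> k x Ox; have [_ ->] := aP x Ox; rewrite pairing_basis.
  - by move=> k x Ox; have [rC _] := FC k; exact: realC1_cont rC Ox.
apply: (realC1_intro oO (df := fun k x => complex.Im (qcoord k (F x)))).
- by move=> x /bP[].
- by move=> k x Ox; have [_ ->] := bP x Ox; rewrite pairing_basis.
- by move=> k x Ox; have [_ iC] := FC k; exact: realC1_cont iC Ox.
Qed.

End Fields.

(** * The Riccati equation and the linear equation in components *)

Section Algebra.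
Variable K : comNzRingType.
Implicit Types (D P : 'I_3 -> 'I_3 -> K) (p q : quat K).

Definition diag_sum D : K := D 0 0 + D 1 1 + D 2%:R 2%:R.

(** Minus the trace of a matrix and its antisymmetric part, the latter read as a
    vector, are the scalar and vector parts of both the Dirac operator (matrix of
    partial derivatives) and the product of two vectors (matrix of products of
    components). Keeping indices [i] and [j] generic replaces the three cross
    product equations by one symmetry. *)
Lemma vector_equationP D P (t : K) :
  Quat (- diag_sum D) (D 1 2%:R - D 2%:R 1) (D 2%:R 0 - D 0 2%:R) (D 0 1 - D 1 0) +
  Quat (- diag_sum P) (P 1 2%:R - P 2%:R 1) (P 2%:R 0 - P 0 2%:R) (P 0 1 - P 1 0) =
  - t%:A <->
  diag_sum D + diag_sum P = t /\ forall i j, D i j + P i j = D j i + P j i.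
Proof.
have e : - t%:A = Quat (- t) 0 0 0 :> quat K by apply: eq_quat => /=; ring.
rewrite e; split=> [[e0 e1 e2 e3]|[e0 sym]]; last first.
  apply: eq_quat => /=.
  - by rewrite -e0 [RHS]opprD.
  - by have := sym 1 2%:R; set a := D 1 _; set b := P 1 _ => H;
      rewrite addrACA -opprD H subrr.
  - by have := sym 2%:R 0; set a := D _ 0; set b := P _ 0 => H;
      rewrite addrACA -opprD H subrr.
  - by have := sym 0 1; set a := D _ 1; set b := P _ 1 => H;
      rewrite addrACA -opprD H subrr.
split; first by apply: oppr_inj; rewrite [LHS]opprD.
have H a b c d : a - b + (c - d) = 0 :> K -> a + c = b + d.
  by move=> h; apply/eqP; rewrite -subr_eq0 opprD addrACA h.
move: e1 e2 e3 => /H e1 /H e2 /H e3.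
by apply: ord3_ind; apply: ord3_ind.
Qed.

Lemma qcoordD k p q : qcoord k (p + q) = qcoord k p + qcoord k q.
Proof. by case: k => [[|[|k]]]. Qed.

End Algebra.

Section Equations.
Variable R : realType.
Local Notation E3 := 'rV[R]_3.
Local Notation d i j F := (partial i (fun y => qcoord j (F y))).
Implicit Types (F q h : E3 -> quat R[i]).
Variable O : set E3.
Hypothesis oO : open O.

Lemma linear_equationP h F x : vectorial O F -> vectorial O h -> O x ->
  Dop F x + rmulq (h x) (F x) = 0 <->
  diag_sum (fun i j => d i j F x) + diag_sum (fun i j => qcoord i (F x) * qcoord j (h x)) = 0
  /\ forall i j, d i j F x + qcoord i (F x) * qcoord j (h x) =
                 d j i F x + qcoord j (F x) * qcoord i (h x).
Proof.
move=> vF vh Ox; rewrite (DopE oO vF Ox) /rmulq (mul_vector (vF x Ox) (vh x Ox)).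
have z : (0 : quat R[i]) = - (0 : R[i])%:A by rewrite scale0r oppr0.
rewrite [X in _ = X <-> _]z.
exact: (vector_equationP (fun i j => d i j F x)
  (fun i j => qcoord i (F x) * qcoord j (h x))).
Qed.

Lemma riccati_equationP q (u : R[i]) x : vectorial O q -> O x ->
  Dop q x + q x ^+ 2 = - u%:A <->
  diag_sum (fun i j => d i j q x) + diag_sum (fun i j => qcoord i (q x) * qcoord j (q x)) = u
  /\ forall i j, d i j q x = d j i q x.
Proof.
move=> vq Ox; rewrite (DopE oO vq Ox) expr2 (mul_vector (vq x Ox) (vq x Ox)).
have [H1 H2] := vector_equationP (fun i j => d i j q x)
  (fun i j => qcoord i (q x) * qcoord j (q x)) u.
split=> [/H1[e s]|[e s]].
  by split=> // i j; have := s i j; rewrite [X in _ = _ + X]mulrC => /addIr.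
by apply: H2; split=> // i j; rewrite s [X in _ + X = _]mulrC.
Qed.

End Equations.

(** * Solutions of the Riccati equation *)

Section Riccati.
Variable R : realType.
Local Notation E3 := 'rV[R]_3.
Local Notation d i j F := (partial i (fun y => qcoord j (F y))).
Implicit Types (F G q h : E3 -> quat R[i]) (f u xi Psi : E3 -> R[i]).

Lemma qcoord_grad k f x : qcoord k (grad f x) = partial k f x.
Proof. by rewrite gradE; move: k; apply: ord3_ind. Qed.

Lemma grad_qcoord f p x : q0 p = 0 -> (forall k, partial k f x = qcoord k p) ->
  grad f x = p.
Proof. by move=> p0 fp; rewrite gradE !fp; apply: eq_quat => /=. Qed.

Variable O : set E3.
Hypothesis oO : open O.

Lemma partial_qcoordD F G i j x : (forall k, isC1 O (fun x => qcoord k (F x))) ->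
  (forall k, isC1 O (fun x => qcoord k (G x))) -> O x ->
  d i j (fun y => F y + G y) x = d i j F x + d i j G x.
Proof.
move=> FC GC Ox; rewrite -(partialD i (FC j) (GC j) Ox).
by congr (partial i _ x); apply/funext => y; rewrite qcoordD.
Qed.

Lemma isC1_qcoordD F G : (forall k, isC1 O (fun x => qcoord k (F x))) ->
  (forall k, isC1 O (fun x => qcoord k (G x))) ->
  forall k, isC1 O (fun x => qcoord k (F x + G x)).
Proof.
move=> FC GC k; apply: (eq_isC1 oO _ (isC1D oO (FC k) (GC k))) => x _.
by rewrite qcoordD.
Qed.

Lemma partial_cexpN f i x : isC1 O f -> O x ->
  partial i (fun y => cexp (- f y)) x = - partial i f x * cexp (- f x).
Proof.
move=> fC Ox; rewrite (partial_cexp i (isC1N oO fC) Ox).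
by rewrite (partialN i fC Ox).
Qed.

(** The vector part of the linear equation says exactly that the product of [F]
    by [cexp (- xi)] is curl free, because [h] is the gradient of [xi]. *)
Lemma linear_sol_potential h xi F : domain O -> simply_connected O ->
  isC1 O xi -> vectorial O h ->
  (forall k x, O x -> qcoord k (h x) = partial k xi x) ->
  linear_sol O h F ->
  exists Psi, isC2 O Psi /\ forall x, O x -> grad Psi x = cexp (- xi x) *: F x.
Proof.
move=> dO scO xiC vh hxi [vF /(qisC1P oO vF) FC linF].
have eC := isC1_cexp oO (isC1N oO xiC).
apply: (curl_free_gradient oO dO scO).
- by move=> x Ox; rewrite /= vF// mulr0.
- exact: scale_isC1.
- move=> i j x Ox; rewrite !(partial_scale _ _ eC FC Ox) !(partial_cexpN _ xiC Ox).
  have [_ sym] := (linear_equationP oO vF vh Ox).1 (linF x Ox).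
  have := sym i j; rewrite (hxi i x Ox) (hxi j x Ox).
  move: (d i j F x) (d j i F x) (qcoord i (F x)) (qcoord j (F x))
    (partial i xi x) (partial j xi x) (cexp (- xi x)) => a b Fi Fj hi hj e E.
  have -> : a = b + Fj * hi - Fi * hj by rewrite -E addrK.
  by ring.
Qed.

(** The vector part of the Riccati equation makes [q] and [h] curl free, hence
    [q - h] is the gradient of some [phi], and [Psi] is the exponential of
    [phi]. The scalar parts of the two Riccati equations, subtracted, give the
    scalar part of the linear equation for [F]. *)
Lemma riccati_sol_log h xi u q : domain O -> simply_connected O ->
  isC1 O xi -> vectorial O h ->
  (forall k x, O x -> qcoord k (h x) = partial k xi x) ->
  riccati_sol O u h -> riccati_sol O u q ->
  exists Psi : E3 -> R[i],
    [/\ isC2 O Psi, forall x, O x -> Psi x != 0,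
        exists F, linear_sol O h F /\
          forall x, O x -> grad Psi x = cexp (- xi x) *: F x &
        forall x, O x -> q x = h x + (Psi x)^-1 *: grad Psi x].
Proof.
move=> dO scO xiC vh hxi [_ /(qisC1P oO vh) hC rich] [vq /(qisC1P oO vq) qC ricq].
(* The difference is written with a scaling, so that one product rule serves. *)
pose g x := q x + (-1) *: h x.
have m1C : isC1 O (fun=> -1 : R[i]) by split; exact: realC1_cst.
have nhC := scale_isC1 oO m1C hC.
have gC : forall k, isC1 O (fun x => qcoord k (g x)) by exact: isC1_qcoordD.
have vg : vectorial O g by move=> x Ox; rewrite /= vq// vh// mulr0 addr0.
have dg i j x : O x -> d i j g x = d i j q x - d i j h x.
  move=> Ox; rewrite (partial_qcoordD i j qC nhC Ox).
  rewrite (partial_scale i j m1C hC Ox) (partial_cst (-1) i x) mul0r add0r.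
  by rewrite mulN1r.
have gE j x : qcoord j (g x) = qcoord j (q x) - qcoord j (h x).
  by rewrite qcoordD qcoordZ mulN1r.
have curlg i j x : O x -> d i j g x = d j i g x.
  move=> Ox; rewrite (dg i j x Ox) (dg j i x Ox).
  have [_ ->] := (riccati_equationP oO _ vq Ox).1 (ricq x Ox).
  by have [_ ->] := (riccati_equationP oO _ vh Ox).1 (rich x Ox).
have [phi [[phiC _] phig]] := curl_free_gradient oO dO scO vg gC curlg.
have dphi k x : O x -> partial k phi x = qcoord k (g x).
  by move=> Ox; rewrite -qcoord_grad phig.
pose Psi x := cexp (phi x).
have PsiC : isC1 O Psi by exact: isC1_cexp.
have dPsi k x : O x -> partial k Psi x = qcoord k (g x) * Psi x.
  by move=> Ox; rewrite (partial_cexp k phiC Ox) dphi.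
have gradPsi x : O x -> grad Psi x = Psi x *: g x.
  move=> Ox; apply: grad_qcoord; first by rewrite /= vq// vh// mulr0 addr0 mulr0.
  by move=> k; rewrite (dPsi k x Ox) qcoordZ mulrC.
have Psi0 x : O x -> Psi x != 0 by move=> _; exact: cexp_neq0.
exists Psi; split; [|exact: Psi0| |].
- split=> [//|k]; apply: (eq_isC1 oO _ (isC1M oO (gC k) PsiC)) => x Ox.
  by rewrite (dPsi k x Ox).
- pose s x := cexp (xi x) * Psi x.
  have exC := isC1_cexp oO xiC.
  have sC : isC1 O s by exact: isC1M.
  have ds i x : O x -> partial i s x = s x * (qcoord i (h x) + qcoord i (g x)).
    move=> Ox; rewrite (partialM i exC PsiC Ox) (dPsi i x Ox) (partial_cexp i xiC Ox) (hxi i x Ox).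
    rewrite /s; move: (partial i xi x) (cexp (xi x)) (Psi x) (qcoord i (g x)) => a b c e.
    by ring.
  pose F x := s x *: g x.
  have vF : vectorial O F by move=> x Ox; rewrite /= vq// vh// mulr0 addr0 mulr0.
  have FC := scale_isC1 oO sC gC.
  exists F; split; last first.
    move=> x Ox; rewrite (gradPsi x Ox) scalerA; congr (_ *: _).
    by rewrite /s mulrA cexpN_cexp mul1r.
  split; [exact: vF|exact/(qisC1P oO vF)|].
  move=> x Ox; apply/(linear_equationP oO vF vh Ox).
  have dF i j : d i j F x = s x * ((qcoord i (h x) + qcoord i (g x)) * qcoord j (g x)
      + d i j g x).
    by rewrite (partial_scale i j sC gC Ox) (ds i x Ox) [RHS]mulrDr [in RHS]mulrA.
  have FE i : qcoord i (F x) = s x * qcoord i (g x) by rewrite qcoordZ.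
  split; last first.
    move=> i j; rewrite !dF !FE (curlg i j x Ox).
    move: (d j i g x) (s x) (qcoord i (h x)) (qcoord i (g x)) (qcoord j (h x))
      (qcoord j (g x)) => *; ring.
  have [divq _] := (riccati_equationP oO _ vq Ox).1 (ricq x Ox).
  have [divh _] := (riccati_equationP oO _ vh Ox).1 (rich x Ox).
  rewrite /diag_sum !dF !FE !(dg _ _ _ Ox) !gE.
  move: divq; rewrite -divh /diag_sum.
  (* The unknowns being abstracted, a polynomial identity remains. *)
  move: (d 0 0 q x) (d 1 1 q x) (d 2%:R 2%:R q x)
    (d 0 0 h x) (d 1 1 h x) (d 2%:R 2%:R h x) (s x)
    (qcoord 0 (q x)) (qcoord 1 (q x)) (qcoord 2%:R (q x))
    (qcoord 0 (h x)) (qcoord 1 (h x)) (qcoord 2%:R (h x)).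
  move=> a b c a' b' c' t k1 k2 k3 l1 l2 l3 E.
  transitivity (t * (a + b + c + (k1 * k1 + k2 * k2 + k3 * k3)
    - (a' + b' + c' + (l1 * l1 + l2 * l2 + l3 * l3)))); first by ring.
  by rewrite E subrr mulr0.
- move=> x Ox; rewrite (gradPsi x Ox) scalerA (mulVf (Psi0 x Ox)) scale1r.
  by rewrite /g scaleN1r addrC subrK.
Qed.

(** The difference [q - h] is [F] multiplied by [cexp (- xi) / Psi], whose logarithmic gradient
    is [- (q - h) - h]. The product rule then carries the linear equation for
    [F] to the Riccati equation for [q]. *)
Lemma riccati_sol_of_linear h xi u q Psi F :
  isC1 O xi -> vectorial O h ->
  (forall k x, O x -> qcoord k (h x) = partial k xi x) ->
  riccati_sol O u h -> vectorial O q ->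
  isC1 O Psi -> (forall x, O x -> Psi x != 0) -> linear_sol O h F ->
  (forall x, O x -> grad Psi x = cexp (- xi x) *: F x) ->
  (forall x, O x -> q x = h x + (Psi x)^-1 *: grad Psi x) ->
  riccati_sol O u q.
Proof.
move=> xiC vh hxi [_ /(qisC1P oO vh) hC rich] vq PsiC Psi0
  [vF /(qisC1P oO vF) FC linF] gradPsi qE.
pose w x := (Psi x)^-1 * cexp (- xi x).
have eC := isC1_cexp oO (isC1N oO xiC).
have VC := isC1V oO PsiC Psi0.
have wC : isC1 O w by exact: isC1M.
have dw i x : O x ->
    partial i w x = - (w x * (w x * qcoord i (F x) + qcoord i (h x))).
  move=> Ox; rewrite (partialM i VC eC Ox) (partialV oO i PsiC Psi0 Ox).
  rewrite (partial_cexpN i xiC Ox) (hxi i x Ox) -(qcoord_grad i Psi) (gradPsi x Ox) qcoordZ /w.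
  have := Psi0 x Ox.
  move: (Psi x) (cexp (- xi x)) (partial i xi x) (qcoord i (F x)) => P e a b P0.
  by field; exact: P0.
pose q' x := h x + w x *: F x.
have qq' x : O x -> q x = q' x.
  by move=> Ox; rewrite (qE x Ox) (gradPsi x Ox) scalerA.
have wFC := scale_isC1 oO wC FC.
have q'C : forall k, isC1 O (fun x => qcoord k (q' x)) by exact: isC1_qcoordD.
have qC : forall k, isC1 O (fun x => qcoord k (q x)).
  by move=> k; apply: (eq_isC1 oO _ (q'C k)) => x Ox; rewrite (qq' x Ox).
split; [exact: vq|exact/(qisC1P oO vq)|].
move=> x Ox; apply/(riccati_equationP oO _ vq Ox).
have dq i j : d i j q x = d i j h x +
    (- (w x * (w x * qcoord i (F x) + qcoord i (h x))) * qcoord j (F x)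
      + w x * d i j F x).
  have -> : d i j q x = d i j q' x.
    by apply: (eq_partial oO i Ox) => y Oy; rewrite (qq' y Oy).
  by rewrite (partial_qcoordD i j hC wFC Ox) (partial_scale i j wC FC Ox) (dw i x Ox).
have q'E i : qcoord i (q x) = qcoord i (h x) + w x * qcoord i (F x).
  by rewrite (qq' x Ox) qcoordD qcoordZ.
have [divF symF] := (linear_equationP oO vF vh Ox).1 (linF x Ox).
have [divh symh] := (riccati_equationP oO _ vh Ox).1 (rich x Ox).
split; last first.
  move=> i j; rewrite !dq symh; congr (_ + _).
  move: (symF i j).
  move: (d i j F x) (d j i F x) (w x) (qcoord i (h x)) (qcoord i (F x))
    (qcoord j (h x)) (qcoord j (F x)) => a b t hi Fi hj Fj E.
  have -> : a = b + Fj * hi - Fi * hj by rewrite -E addrK.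
  by ring.
rewrite -divh /diag_sum !dq !q'E.
move: divF; rewrite /diag_sum.
move: (d 0 0 F x) (d 1 1 F x) (d 2%:R 2%:R F x)
    (d 0 0 h x) (d 1 1 h x) (d 2%:R 2%:R h x) (w x)
    (qcoord 0 (F x)) (qcoord 1 (F x)) (qcoord 2%:R (F x))
    (qcoord 0 (h x)) (qcoord 1 (h x)) (qcoord 2%:R (h x)).
move=> a b c a' b' c' t k1 k2 k3 l1 l2 l3 E.
transitivity (a' + b' + c' + (l1 * l1 + l2 * l2 + l3 * l3) +
  t * (a + b + c + (k1 * l1 + k2 * l2 + k3 * l3))); first by ring.
by rewrite E mulr0 addr0.
Qed.

End Riccati.

Theorem theorem6 (R : realType) (Omega : set 'rV[R]_3)
    (u xi : 'rV[R]_3 -> R[i]) (h : 'rV[R]_3 -> quat R[i])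
    (Omega_domain : domain Omega)
    (Omega_sc : simply_connected Omega)
    (xi_C2 : isC2 Omega xi)
    (h_grad : forall x, Omega x -> h x = grad xi x)
    (h_sol : riccati_sol Omega u h) :
  (forall F : 'rV[R]_3 -> quat R[i], linear_sol Omega h F ->
     exists Psi : 'rV[R]_3 -> R[i], isC2 Omega Psi /\
       forall x, Omega x -> grad Psi x = cexp (- xi x) *: F x)
  /\
  (forall q : 'rV[R]_3 -> quat R[i], vectorial Omega q ->
     (riccati_sol Omega u q <->
      exists Psi : 'rV[R]_3 -> R[i],
        [/\ isC2 Omega Psi,
            forall x, Omega x -> Psi x != 0,
            exists F : 'rV[R]_3 -> quat R[i], linear_sol Omega h F /\
              forall x, Omega x -> grad Psi x = cexp (- xi x) *: F x &
            forall x, Omega x ->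
              q x = h x + (Psi x)^-1 *: Dop (fun y => (Psi y)%:A) x])).
Proof.
have [oO _ _] := Omega_domain; have [xiC _] := xi_C2; have [vh _ _] := h_sol.
have hxi k x : Omega x -> qcoord k (h x) = partial k xi x.
  by move=> Ox; rewrite h_grad// qcoord_grad.
split=> [F linF|q vq]; first exact: (linear_sol_potential oO _ _ xiC vh hxi linF).
split=> [ricq|[Psi [[PsiC _] Psi0 [F [linF gradPsi]] qE]]].
  have [Psi [PsiC Psi0 linF qE]] :=
    riccati_sol_log oO Omega_domain Omega_sc xiC vh hxi h_sol ricq.
  by exists Psi; split=> // x Ox; rewrite Dop_scalar; exact: qE.
apply: (riccati_sol_of_linear oO xiC vh hxi h_sol vq PsiC Psi0 linF gradPsi).
by move=> x Ox; rewrite qE// Dop_scalar.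
Qed.
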